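(* Let $\mathcal{U} = \mathbb{T}^p\times B^q$ with coordinates $(\theta_1\bmod 1,\dots,\theta_p\bmod1, r_1,\dots,r_q)$, $B^q$ a ball in $\mathbb{R}^q$, and let $Z = \sum_{i=1}^p a_i(r_1,\dots,r_q)\partial_{\theta_i}$ with smooth functions $a_i$. Assume $a_1,\dots,a_p$ are incommensurable: there is no nonzero $(k_1,\dots,k_p)\in\mathbb{Z}^p$ such that $\sum_i k_i a_i(r) = 0$ on an open subset. Let $\Lambda$ be a linear differential operator on $\mathcal{U}$ with $Z\circ\Lambda - \Lambda\circ Z = 0$. Then $\Lambda$ is invariant under the natural free $\mathbb{T}^p$-action on $\mathcal{U}$ by translations in $\theta$; equivalently, when written as $\Lambda = \sum_{I,J} C_{I,J}(\theta,r)\,\partial_\theta^I\partial_r^J$, all coefficients $C_{I,J}$ are independent of $\theta$.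
   Context: Multi-index notation: $\partial_\theta^I = \partial_{\theta_1}^{i_1}\cdots\partial_{\theta_p}^{i_p}$ for $I=(i_1,\dots,i_p)$, similarly $\partial_r^J$. *)

(* Defs.v *)
From mathcomp Require Import ssreflect ssrbool eqtype ssrnat fintype finfun bigop.
From Stdlib Require Import Reals ZArith.

Set Implicit Arguments.
Unset Strict Implicit.

Definition upd {T : eqType} (x : T -> R) (k : T) (t : R) : T -> R :=
  fun k' => if k' == k then t else x k'.

Definition mi0 {T : Type} : T -> nat := fun _ => 0%N.
Definition mi_add_e {T : eqType} (al : T -> nat) (k : T) : T -> nat :=
  fun k' => if k' == k then (al k').+1 else al k'.
Definition mi_e {T : eqType} (k : T) : T -> nat := mi_add_e mi0 k.

Definition open_set {T : finType} (U : (T -> R) -> Prop) : Prop :=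
  forall x, U x -> exists eps, (eps > 0)%R /\
    forall y, (forall k, (Rabs (y k - x k) < eps)%R) -> U y.

Definition cont_on {T : finType} (U : (T -> R) -> Prop) (g : (T -> R) -> R) : Prop :=
  forall x, U x -> forall eps, (eps > 0)%R -> exists delta, (delta > 0)%R /\
    forall y, U y -> (forall k, (Rabs (y k - x k) < delta)%R) ->
      (Rabs (g y - g x) < eps)%R.

(* D is the family of all partial derivatives of f on the open set U:
   D mi0 = f, every D al is continuous on U, and the partial derivative of
   D al in the k-th coordinate is D (al + e_k).  Such a family exists iff f is
   C^infinity on U (and it is then unique on U). *)
Definition is_deriv_family {T : finType} (U : (T -> R) -> Prop)
    (f : (T -> R) -> R) (D : (T -> nat) -> (T -> R) -> R) : Prop :=
  (forall x, U x -> D mi0 x = f x) /\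
  (forall al, cont_on U (D al)) /\
  (forall al k x, U x ->
     derivable_pt_lim (fun t => D al (upd x k t)) (x k) (D (mi_add_e al k) x)).

Definition smooth_on {T : finType} (U : (T -> R) -> Prop) (f : (T -> R) -> R) : Prop :=
  exists D, is_deriv_family U f D.

Definition coord (p q : nat) : finType := ('I_p + 'I_q)%type.
Definition point (p q : nat) := coord p q -> R.
Definition rpart {p q : nat} (x : point p q) : 'I_q -> R := fun j => x (inr j).

Definition in_ball {q : nat} (c : 'I_q -> R) (rho : R) (r : 'I_q -> R) : Prop :=
  (\big[Rplus/R0]_(j : 'I_q) ((r j - c j) * (r j - c j)) < rho * rho)%R.

(* U = T^p x B^q, realised as the open set R^p x B^q with 1-periodicity in theta *)
Definition domU {p q : nat} (c : 'I_q -> R) (rho : R) (x : point p q) : Prop :=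
  in_ball c rho (rpart x).

Definition theta_periodic {p q : nat} (c : 'I_q -> R) (rho : R) (f : point p q -> R) : Prop :=
  forall x (i : 'I_p), domU c rho x ->
    f (upd x (inl i) (x (inl i) + 1)%R) = f x.

Definition smooth_fun_U {p q : nat} (c : 'I_q -> R) (rho : R) (f : point p q -> R) : Prop :=
  theta_periodic c rho f /\ smooth_on (domU c rho) f.

Definition incommensurable {p q : nat} (c : 'I_q -> R) (rho : R)
    (a : 'I_p -> ('I_q -> R) -> R) : Prop :=
  forall k : 'I_p -> Z, (exists i, k i <> 0%Z) ->
    ~ (exists V : ('I_q -> R) -> Prop,
         open_set V /\ (exists r, V r) /\ (forall r, V r -> in_ball c rho r) /\
         forall r, V r -> (\big[Rplus/R0]_(i : 'I_p) (IZR (k i) * a i r) = 0)%R).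

(* Z f = sum_i a_i(r) d_{theta_i} f, given the derivative family Df of f *)
Definition applyZ {p q : nat} (a : 'I_p -> ('I_q -> R) -> R)
    (Df : (coord p q -> nat) -> point p q -> R) : point p q -> R :=
  fun x => \big[Rplus/R0]_(i : 'I_p) (a i (rpart x) * Df (mi_e (inl i : coord p q)) x)%R.

Definition mindex (p q N : nat) : finType := {ffun coord p q -> 'I_N.+1}.
Definition mi_of {p q N : nat} (al : mindex p q N) : coord p q -> nat :=
  fun k => nat_of_ord (al k).

Definition applyL {p q N : nat} (C : mindex p q N -> point p q -> R)
    (Df : (coord p q -> nat) -> point p q -> R) : point p q -> R :=
  fun x => \big[Rplus/R0]_(al : mindex p q N) (C al x * Df (mi_of al) x)%R.

(* Main.v *)
Require Import Defs.
From HB Require Import structures.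
From mathcomp Require Import ssreflect ssrfun ssrbool eqtype ssrnat seq path choice fintype finfun bigop.
From Stdlib Require Import Reals ZArith Lra Lia Classical ClassicalEpsilon FunctionalExtensionality.

(** The coefficients are treated by descending induction on a weight of (I, J) that is lexicographic in (|J|, |I|).
    Apply Z Lambda = Lambda Z to the test function f(x) = prod_k sin(2 pi (x_k - z_k))^(alpha_k), centred at z, and
    evaluate at z.  The jet of f at z does not depend on z and vanishes below alpha; and the commutator of d^beta with
    the a_i strictly lowers the order in r.  Hence Z C_alpha (z), up to a nonzero constant, is a combination of
    coefficients of larger weight, with weights depending on r only, so that Z C_alpha does not depend on theta.
    As C_alpha is bounded on each torus it grows linearly along the flow only if Z C_alpha = 0, so C_alpha is invariant
    under the flow.

    To pass from invariance to independence of theta without a Baire argument, fix r and a degree n, and move r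
    slightly so that k . a(r) <> 0 for the finitely many resonances k of size at most n + 1.  A half-sum of two
    translates along the flow, at a time t with 2 t (k . a(r)) = 1, kills the mode k, and finitely many of these
    reduce a trigonometric polynomial to its mean while fixing every flow-invariant function.  Since these operations
    preserve positivity, an estimate |c - c(0)| <= eps + B sum_j (1 - cos(2 pi theta_j)), multiplied by the Fejer
    kernel of degree n, becomes |c - c(0)| <= eps + B p / (n + 1). *)

Set Implicit Arguments.
Unset Strict Implicit.

Local Open Scope R_scope.

(** * Iterated sums and products of real numbers *)

HB.instance Definition _ := Monoid.isComLaw.Build R R0 Rplus
  (fun x y z => esym (Rplus_assoc x y z)) Rplus_comm Rplus_0_l.
HB.instance Definition _ := Monoid.isComLaw.Build R R1 Rmult
  (fun x y z => esym (Rmult_assoc x y z)) Rmult_comm Rmult_1_l.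
HB.instance Definition _ := Monoid.isMulLaw.Build R R0 Rmult Rmult_0_l Rmult_0_r.
HB.instance Definition _ := Monoid.isAddLaw.Build R Rmult Rplus
  Rmult_plus_distr_r Rmult_plus_distr_l.


(** * Derivative families of sums and products *)

Lemma mi_add_eC (T : eqType) (b : T -> nat) j k :
  mi_add_e (mi_add_e b j) k = mi_add_e (mi_add_e b k) j.
Proof.
apply: functional_extensionality => i; rewrite /mi_add_e.
by case: (i == k); case: (i == j).
Qed.

Section Continuity.
Variable T : finType.
Implicit Types (U : (T -> R) -> Prop) (f g : (T -> R) -> R).

Lemma cont_on_const U (d : R) : cont_on U (fun _ => d).
Proof.
move=> x _ e e0; exists 1; split; first lra.
by move=> y _ _; rewrite Rminus_diag Rabs_R0.
Qed.

Lemma cont_on_add U f g :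
  cont_on U f -> cont_on U g -> cont_on U (fun x => f x + g x).
Proof.
move=> cf cg x Ux e e0.
have e2 : e / 2 > 0 by lra.
have [d1 [d10 h1]] := cf x Ux _ e2; have [d2 [d20 h2]] := cg x Ux _ e2.
exists (Rmin d1 d2); split; first exact: Rmin_Rgt_r.
move=> y Uy yx.
have A := h1 y Uy (fun k => Rlt_le_trans _ _ _ (yx k) (Rmin_l _ _)).
have B := h2 y Uy (fun k => Rlt_le_trans _ _ _ (yx k) (Rmin_r _ _)).
move: A B; split_Rabs; lra.
Qed.

Lemma cont_on_mul U f g :
  cont_on U f -> cont_on U g -> cont_on U (fun x => f x * g x).
Proof.
move=> cf cg x Ux e e0.
set K := Rabs (f x) + Rabs (g x) + 1.
have K0 : K > 0 by rewrite /K; have := Rabs_pos (f x); have := Rabs_pos (g x); lra.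
have eK : e / K > 0 by apply: Rdiv_lt_0_compat; lra.
set eta := Rmin 1 (e / K).
have eta0 : eta > 0 by apply: Rmin_Rgt_r; split; lra.
have [d1 [d10 h1]] := cf x Ux _ eta0; have [d2 [d20 h2]] := cg x Ux _ eta0.
exists (Rmin d1 d2); split; first exact: Rmin_Rgt_r.
move=> y Uy yx.
have A := h1 y Uy (fun k => Rlt_le_trans _ _ _ (yx k) (Rmin_l _ _)).
have B := h2 y Uy (fun k => Rlt_le_trans _ _ _ (yx k) (Rmin_r _ _)).
have -> : f y * g y - f x * g x
  = (f y - f x) * (g y - g x) + (f y - f x) * g x + f x * (g y - g x) by ring.
have eta1 : eta <= 1 by exact: Rmin_l.
have etaK : eta * K <= e.
  have := Rmin_r 1 (e / K); rewrite -/eta => h.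
  have -> : e = e / K * K by field; lra.
  by apply: Rmult_le_compat_r; lra.
apply: Rle_lt_trans (Rabs_triang _ _) _.
apply: Rle_lt_trans (Rplus_le_compat_r _ _ _ (Rabs_triang _ _)) _.
rewrite !Rabs_mult; move: A B etaK; rewrite /K.
have := Rabs_pos (f y - f x); have := Rabs_pos (g y - g x).
have := Rabs_pos (f x); have := Rabs_pos (g x).
move: (Rabs (f x)) (Rabs (g x)) (Rabs (f y - f x)) (Rabs (g y - g x)).
move=> s t u v ? ? ? ? ? ? ?.
nra.
Qed.

Lemma cont_on_sum U (I : Type) (l : seq I) (P : pred I) (F : I -> (T -> R) -> R) :
  (forall i, cont_on U (F i)) ->
  cont_on U (fun x => \big[Rplus/R0]_(i <- l | P i) F i x).
Proof.
move=> cF; elim: l => [|i l IH].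
  have -> : (fun x => \big[Rplus/R0]_(i <- [::] | P i) F i x) = fun _ => 0.
    by apply: functional_extensionality => x; rewrite big_nil.
  exact: cont_on_const.
have -> : (fun x => \big[Rplus/R0]_(j <- i :: l | P j) F j x)
  = fun x => (if P i then F i x else 0) + \big[Rplus/R0]_(j <- l | P j) F j x.
  apply: functional_extensionality => x; rewrite big_cons.
  by case: (P i) => //; rewrite Rplus_0_l.
apply: cont_on_add => //; case: (P i); [exact: cF | exact: cont_on_const].
Qed.

Lemma cont_on_prod U (I : Type) (l : seq I) (F : I -> (T -> R) -> R) :
  (forall i, cont_on U (F i)) ->
  cont_on U (fun x => \big[Rmult/R1]_(i <- l) F i x).
Proof.
move=> cF; elim: l => [|i l IH].
  have -> : (fun x => \big[Rmult/R1]_(i <- [::]) F i x) = fun _ => 1.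
    by apply: functional_extensionality => x; rewrite big_nil.
  exact: cont_on_const.
have -> : (fun x => \big[Rmult/R1]_(j <- i :: l) F j x)
  = fun x => F i x * \big[Rmult/R1]_(j <- l) F j x.
  by apply: functional_extensionality => x; rewrite big_cons.
exact: cont_on_mul.
Qed.

Lemma cont_on_coord U (k : T) (phi : R -> R) :
  continuity phi -> cont_on U (fun x => phi (x k)).
Proof.
move=> cphi x _ e e0.
have [d [d0 h]] := cphi (x k) e e0.
exists d; split=> // y _ yx.
case: (Req_dec (y k) (x k)) => [->|ne]; first by rewrite Rminus_diag Rabs_R0.
by apply: h; split; [split=> //; exact: not_eq_sym | exact: yx].
Qed.

End Continuity.

Lemma derivable_pt_lim_sum (I : Type) (l : seq I) (P : pred I) (F : I -> R -> R) (d : I -> R) t :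
  (forall i, derivable_pt_lim (F i) t (d i)) ->
  derivable_pt_lim (fun t => \big[Rplus/R0]_(i <- l | P i) F i t) t
    (\big[Rplus/R0]_(i <- l | P i) d i).
Proof.
move=> dF; elim: l => [|i l IH].
  have -> : (fun x => \big[Rplus/R0]_(i <- [::] | P i) F i x) = fct_cte 0.
    by apply: functional_extensionality => x; rewrite big_nil.
  rewrite big_nil; exact: derivable_pt_lim_const.
have -> : (fun x => \big[Rplus/R0]_(j <- i :: l | P j) F j x)
  = plus_fct (fun x => if P i then F i x else 0) (fun x => \big[Rplus/R0]_(j <- l | P j) F j x).
  apply: functional_extensionality => x; rewrite big_cons /plus_fct.
  by case: (P i) => //; rewrite Rplus_0_l.
have -> : \big[Rplus/R0]_(j <- i :: l | P j) d j
  = (if P i then d i else 0) + \big[Rplus/R0]_(j <- l | P j) d j.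
  by rewrite big_cons; case: (P i) => //; rewrite Rplus_0_l.
apply: derivable_pt_lim_plus => //; case: (P i) => //.
exact: (derivable_pt_lim_const 0).
Qed.

Section DerivFamilies.
Variable T : finType.
Implicit Types (U : (T -> R) -> Prop) (D F G : (T -> nat) -> (T -> R) -> R).

(** A multi-index as a word in the coordinates, so that iterated derivatives can be defined by
    recursion on the word. *)
Definition directions (al : T -> nat) : seq T :=
  flatten [seq nseq (al k) k | k <- enum T].

Lemma count_directions al k : count_mem k (directions al) = al k.
Proof.
rewrite /directions count_flatten -map_comp sumnE big_map big_enum /=.
rewrite (bigD1 k) //= count_nseq /= eqxx mul1n big1 ?addn0 // => i ik.
by rewrite count_nseq /= (negbTE ik).
Qed.

Lemma perm_directions_add_e al k :
  perm_eq (directions (mi_add_e al k)) (k :: directions al).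
Proof.
apply/allP => i _ /=; rewrite !count_directions /mi_add_e (eq_sym k i).
by case: (i == k).
Qed.

Lemma directions0 : directions mi0 = [::].
Proof.
apply/size0nil/eqP; rewrite -leqn0 leqNgt -has_predT.
apply/hasPn => k; rewrite -has_pred1 has_count count_directions.
by [].
Qed.

(** The word of [mi_add_e al k] is only a permutation of [k :: directions al]; this is why [G] must
    be invariant under permutations. *)
Lemma is_deriv_family_of_lists U (G : seq T -> (T -> R) -> R) :
  (forall l l', perm_eq l l' -> G l = G l') ->
  (forall l, cont_on U (G l)) ->
  (forall l k x, U x ->
     derivable_pt_lim (fun t => G l (upd x k t)) (x k) (G (k :: l) x)) ->
  is_deriv_family U (G [::]) (fun al => G (directions al)).
Proof.
move=> Gp Gc Gd; split; first by move=> x _; rewrite directions0.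
split=> [al|al k x Ux]; first exact: Gc.
rewrite (Gp _ _ (perm_directions_add_e al k)); exact: Gd.
Qed.

(** The product rule without binomial coefficients: each letter of [l] goes to [F] or to [G], and
    [b], [g] record what each factor has received. *)
Fixpoint leibniz F G (l : seq T) (b g : T -> nat) (x : T -> R) : R :=
  if l is k :: l' then
    leibniz F G l' (mi_add_e b k) g x + leibniz F G l' b (mi_add_e g k) x
  else F b x * G g x.

Lemma leibniz_swap F G l1 k l2 b g x :
  leibniz F G (l1 ++ k :: l2) b g x = leibniz F G (k :: l1 ++ l2) b g x.
Proof.
elim: l1 b g => [//|j l1 IH] b g /=.
rewrite !IH /= (mi_add_eC b) (mi_add_eC g); ring.
Qed.

Lemma leibniz_perm F G l l' : perm_eq l l' -> leibniz F G l = leibniz F G l'.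
Proof.
move=> ll'; apply: functional_extensionality => b.
apply: functional_extensionality => g; apply: functional_extensionality => x.
elim: l l' ll' b g x => [|k l IH] l' ll' b g x.
  by move: ll'; rewrite perm_sym => /perm_nilP ->.
have : k \in l' by rewrite -(perm_mem ll') mem_head.
move=> kl'; case/splitPr: kl' ll' => l1 l2; rewrite leibniz_swap.
rewrite perm_sym -[k :: l2]cat1s perm_catCA /= perm_cons perm_sym => ll'.
by rewrite /= !(IH _ ll').
Qed.

Definition mul_family F G (al : T -> nat) : (T -> R) -> R :=
  leibniz F G (directions al) mi0 mi0.

Definition is_family U D := is_deriv_family U (D mi0) D.

Lemma leibniz_cont U F G l b g :
  is_family U F -> is_family U G -> cont_on U (leibniz F G l b g).
Proof.
move=> [_ [cF _]] [_ [cG _]]; elim: l b g => [|k l IH] b g /=.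
  by apply: cont_on_mul.
exact: cont_on_add.
Qed.

(** Differentiating a leaf splits it exactly as a further letter [k] would, and increments of
    multi-indices commute, so [k] may be moved to the front. *)
Lemma leibniz_deriv U F G l b g k x :
  is_family U F -> is_family U G -> U x ->
  derivable_pt_lim (fun t => leibniz F G l b g (upd x k t)) (x k)
    (leibniz F G (k :: l) b g x).
Proof.
move=> [_ [_ dF]] [_ [_ dG]] Ux; elim: l b g => [|j l IH] b g.
  have /= H := derivable_pt_lim_mult _ _ _ _ _ (dF b k x Ux) (dG g k x Ux).
  move: H; rewrite /mult_fct.
  suff -> : upd x k (x k) = x by [].
  by apply: functional_extensionality => i; rewrite /upd; case: eqP => [->|].
have /= H := derivable_pt_lim_plus _ _ _ _ _ (IH (mi_add_e b j) g) (IH b (mi_add_e g j)).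
rewrite /= (mi_add_eC b k j) (mi_add_eC g k j).
move: H; rewrite /plus_fct => H.
by apply: (eq_rect _ (derivable_pt_lim _ _) H); ring.
Qed.

Lemma mul_family_is_family U F G f g :
  is_deriv_family U f F -> is_deriv_family U g G ->
  is_deriv_family U (fun x => f x * g x) (mul_family F G).
Proof.
move=> [F0 [cF dF]] [G0 [cG dG]].
have hF : is_family U F by split.
have hG : is_family U G by split.
have [h0 [h1 h2]] := is_deriv_family_of_lists
  (fun l l' (h : perm_eq l l') => congr1 (fun u => u mi0 mi0) (leibniz_perm F G h))
  (fun l => leibniz_cont l mi0 mi0 hF hG)
  (fun l k x Ux => leibniz_deriv l mi0 mi0 k hF hG Ux).
split; last by split.
by move=> x Ux; rewrite -F0 // -G0 //; exact: h0.
Qed.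

Lemma mul_family_e F G k x :
  mul_family F G (mi_e k) x = F (mi_e k) x * G mi0 x + F mi0 x * G (mi_e k) x.
Proof.
by rewrite /mul_family (leibniz_perm _ _ (perm_directions_add_e mi0 k)) directions0.
Qed.

Lemma sum_family_is_family U (I : Type) (l : seq I) (P : pred I)
    (f : I -> (T -> R) -> R) (D : I -> (T -> nat) -> (T -> R) -> R) :
  (forall i, is_deriv_family U (f i) (D i)) ->
  is_deriv_family U (fun x => \big[Rplus/R0]_(i <- l | P i) f i x)
    (fun al x => \big[Rplus/R0]_(i <- l | P i) D i al x).
Proof.
move=> hD; split; [|split].
- by move=> x Ux; apply: eq_bigr => i _; case: (hD i) => ->.
- by move=> al; apply: cont_on_sum => i; case: (hD i) => _ [].
- move=> al k x Ux; apply: derivable_pt_lim_sum => i.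
  by case: (hD i) => _ [_]; apply.
Qed.

Definition mi_add (al b : T -> nat) : T -> nat := fun k => (al k + b k)%nat.

Lemma shift_family_is_family U f D b :
  is_deriv_family U f D ->
  is_deriv_family U (D b) (fun al => D (mi_add al b)).
Proof.
move=> [_ [cD dD]]; split; [|split] => [x _|al|al k x Ux].
- by congr (D _ x).
- exact: cD.
- have -> : mi_add (mi_add_e al k) b = mi_add_e (mi_add al b) k.
    apply: functional_extensionality => i; rewrite /mi_add /mi_add_e.
    by case: (i == k).
  exact: dD.
Qed.

End DerivFamilies.

(** * Test functions *)

(** For a function of r alone, every multi-index with a theta direction gives 0. *)
Definition lift_family p q (D : ('I_q -> nat) -> ('I_q -> R) -> R)
    (al : coord p q -> nat) (x : point p q) : R :=
  if [forall i : 'I_p, al (inl i) == O] then D (fun j => al (inr j)) (rpart x) else 0.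

Lemma lift_family_is_family p q (c : 'I_q -> R) rho a D :
  is_deriv_family (in_ball c rho) a D ->
  is_deriv_family (domU c rho) (fun x => a (rpart x)) (@lift_family p q D).
Proof.
move=> [D0 [cD dD]]; split; [|split].
- move=> x Ux; rewrite /lift_family; case: ifP => [_|/forallP h].
    by rewrite -D0.
  by case: h.
- move=> al; rewrite /lift_family; case: [forall i : 'I_p, _]; last exact: cont_on_const.
  move=> x Ux e e0; have [d [d0 h]] := cD (fun j => al (inr j)) _ Ux e e0.
  by exists d; split=> // y Uy yx; apply: h => // k; apply: yx.
- move=> al [i|j] x Ux.
    have -> : lift_family D (mi_add_e al (inl i)) x = 0.
      rewrite /lift_family; case: ifP => // /forallP /(_ i).
      by rewrite /mi_add_e eqxx.
    exact: (derivable_pt_lim_const (lift_family D al x)).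
  rewrite /lift_family.
  have -> : [forall i : 'I_p, mi_add_e al (inr j) (inl i) == O]
          = [forall i : 'I_p, al (inl i) == O] by [].
  case: [forall i : 'I_p, _]; last exact: (derivable_pt_lim_const 0).
  have := dD (fun j => al (inr j)) j (rpart x) Ux.
  exact.
Qed.

(* [sincos n a b] is the n-th derivative of sin^a cos^b (2 pi x). *)
Fixpoint sincos (n a b : nat) (x : R) : R :=
  if n is n'.+1 then
    2 * PI * (INR a * sincos n' a.-1 b.+1 x - INR b * sincos n' a.+1 b.-1 x)
  else sin (2 * PI * x) ^ a * cos (2 * PI * x) ^ b.

Lemma sincos_deriv n a b x :
  derivable_pt_lim (sincos n a b) x (sincos n.+1 a b x).
Proof.
elim: n a b => [|n IH] a b.
  have dl : derivable_pt_lim (fun x => 2 * PI * x) x (2 * PI * 1).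
    exact: (derivable_pt_lim_scal id (2 * PI) x 1 (derivable_pt_lim_id x)).
  have ds := derivable_pt_lim_comp _ _ _ _ _ dl (derivable_pt_lim_sin (2 * PI * x)).
  have dc := derivable_pt_lim_comp _ _ _ _ _ dl (derivable_pt_lim_cos (2 * PI * x)).
  have dsa := derivable_pt_lim_comp _ _ _ _ _ ds (derivable_pt_lim_pow _ a).
  have dcb := derivable_pt_lim_comp _ _ _ _ _ dc (derivable_pt_lim_pow _ b).
  have := derivable_pt_lim_mult _ _ _ _ _ dsa dcb.
  rewrite /mult_fct /comp /= => H.
  by apply: (eq_rect _ (derivable_pt_lim _ _) H); ring.
have h1 := derivable_pt_lim_scal _ (INR a) _ _ (IH a.-1 b.+1).
have h2 := derivable_pt_lim_scal _ (INR b) _ _ (IH a.+1 b.-1).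
exact: derivable_pt_lim_scal _ (2 * PI) _ _ (derivable_pt_lim_minus _ _ _ _ _ h1 h2).
Qed.

Lemma sincos_periodic n a b x : sincos n a b (x + 1) = sincos n a b x.
Proof.
elim: n a b => [|n IH] a b /=; last by rewrite !IH.
have -> : 2 * PI * (x + 1) = 2 * PI * x + 2 * PI by ring.
by rewrite sin_plus cos_plus sin_2PI cos_2PI;
   congr (_ ^ _ * _ ^ _); ring.
Qed.

(** Each differentiation lowers the exponent of the sine by at most one, so every term keeps a
    positive power of it. *)
Lemma sincos_vanish n a b : (n < a)%nat -> sincos n a b 0 = 0.
Proof.
elim: n a b => [|n IH] a b na /=.
  by rewrite Rmult_0_r sin_0; case: a na => //= a _; ring.
case: a na => // a na /=; rewrite IH // IH; first by ring.
by rewrite ltnW // ltnS ltnW.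
Qed.

(** Only the branch that differentiates a sine every time survives at 0; it contributes (2 pi)^a
    a!. *)
Lemma sincos_diag a b : sincos a a b 0 <> 0.
Proof.
elim: a b => [|a IH] b /=.
  by rewrite Rmult_0_r cos_0 pow1; lra.
(* Differentiating the cosine raises the sine exponent to [a.+2], too high for the [a] derivatives
   that are left. *)
rewrite [sincos a a.+2 _ 0]sincos_vanish // Rmult_0_r Rminus_0_r.
apply: Rmult_integral_contrapositive_currified.
  by have := PI_RGT_0; lra.
apply: Rmult_integral_contrapositive_currified => //.
exact: (not_0_INR a.+1).
Qed.

Section TestFunctions.
Variable T : finType.
Implicit Types (al be : T -> nat) (x y z : T -> R).

(** A 1-periodic substitute for the monomial (x - z)^al, differentiated [be] times. *)
Definition test_family al z be x : R :=
  \big[Rmult/R1]_(k : T) sincos (be k) (al k) 0 (x k - z k).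

Definition test_jet al be : R := \big[Rmult/R1]_(k : T) sincos (be k) (al k) 0 0.

Lemma test_family_center al z be : test_family al z be z = test_jet al be.
Proof. by apply: eq_bigr => k _; rewrite Rminus_diag. Qed.

Lemma test_family_is_family U al z : is_family U (test_family al z).
Proof.
split=> [//|]; split.
  move=> be; apply: cont_on_prod => k.
  apply: (@cont_on_coord T U k (fun u => sincos (be k) (al k) 0 (u - z k))).
  move=> u; apply: derivable_continuous_pt.
  exists (sincos (be k).+1 (al k) 0 (u - z k) * (1 - 0)).
  apply: (derivable_pt_lim_comp (fun u => u - z k)); last exact: sincos_deriv.
  apply: derivable_pt_lim_minus; [exact: derivable_pt_lim_id | exact: derivable_pt_lim_const].
move=> be k x _.
rewrite /test_family (bigD1 k) //=.
set A := sincos _ _ _ _; set K := \big[_/_]_(_ | _) _.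
have EK : K = \big[Rmult/R1]_(i | i != k) sincos (be i) (al i) 0 (x i - z i).
  by apply: eq_bigr => i /negbTE ik; rewrite /mi_add_e ik.
have -> : (fun t => \big[Rmult/R1]_k0 sincos (be k0) (al k0) 0 (upd x k t k0 - z k0))
  = mult_fct (fun t => sincos (be k) (al k) 0 (t - z k)) (fct_cte K).
  apply: functional_extensionality => t; rewrite (bigD1 k) //= /upd eqxx EK.
  by congr (_ * _); apply: eq_bigr => i /negbTE ->.
have -> : A * K = A * (1 - 0) * fct_cte K (x k) + sincos (be k) (al k) 0 (x k - z k) * 0.
  by rewrite /fct_cte; ring.
apply: derivable_pt_lim_mult; last exact: derivable_pt_lim_const.
apply: (derivable_pt_lim_comp (fun u => u - z k)); last first.
  rewrite /A /mi_add_e eqxx; exact: sincos_deriv.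
apply: derivable_pt_lim_minus; [exact: derivable_pt_lim_id | exact: derivable_pt_lim_const].
Qed.

Lemma test_family_periodic al z be x k :
  test_family al z be (upd x k (x k + 1)) = test_family al z be x.
Proof.
apply: eq_bigr => i _; rewrite /upd; case: eqP => // ->.
have -> : x k + 1 - z k = x k - z k + 1 by ring.
exact: sincos_periodic.
Qed.

Lemma test_jet_vanish al be k : (be k < al k)%nat -> test_jet al be = 0.
Proof. by move=> h; rewrite /test_jet (bigD1 k) //= sincos_vanish // Rmult_0_l. Qed.

Lemma test_jet_diag al : test_jet al al <> 0.
Proof.
apply: (big_ind (fun u => u <> 0)) => [|u v|k _]; first by lra.
  exact: Rmult_integral_contrapositive_currified.
exact: sincos_diag.
Qed.

End TestFunctions.

Section LeibnizEval.
Variable T : finType.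
Implicit Types (F G : (T -> nat) -> (T -> R) -> R) (l : seq T) (b g : T -> nat).

(** Along the expansion the total order is preserved and the index on [F] only grows, so the
    hypothesis reaches every leaf. *)
Lemma leibniz_vanish F G l b g x :
  (forall b' g', (forall k, b' k + g' k = b k + g k + count_mem k l)%nat ->
     (forall k, b k <= b' k)%nat -> F b' x * G g' x = 0) ->
  leibniz F G l b g x = 0.
Proof.
elim: l b g => [|j l IH] b g H /=; first by apply: H => k //; rewrite addn0.
rewrite !IH; first by ring.
  move=> b' g' e le; apply: H => // k; rewrite e /mi_add_e /= (eq_sym j).
  by case: (k == j); rewrite /= ?addnS ?addSn.
move=> b' g' e le; apply: H => k.
  by rewrite e /mi_add_e /= (eq_sym j); case: (k == j); rewrite /= ?addnS ?addSn.
apply: leq_trans (le k); rewrite /mi_add_e; case: (k == j) => //.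
Qed.

(** The leaf that sends every letter to [G] is the only one without a derivative on [F]; the
    hypothesis kills the others. *)
Lemma leibniz_head F G l g x :
  (forall b' g', (forall k, b' k + g' k = g k + count_mem k l)%nat ->
     (exists k, 0 < b' k)%nat -> F b' x * G g' x = 0) ->
  leibniz F G l mi0 g x = F mi0 x * G (fun k => g k + count_mem k l)%nat x.
Proof.
elim: l g => [|j l IH] g H /=.
  by congr (_ * G _ _); apply: functional_extensionality => k; rewrite addn0.
rewrite leibniz_vanish ?IH ?Rplus_0_l.
- congr (_ * G _ _); apply: functional_extensionality => k.
  by rewrite /mi_add_e (eq_sym j); case: (k == j); rewrite /= ?addnS ?addSn.
- move=> b' g' e le; apply: H => // k; rewrite e /mi_add_e /= (eq_sym j).
  by case: (k == j); rewrite /= ?addnS ?addSn.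
- move=> b' g' e le; apply: H => [k|].
    by rewrite e /mi_add_e /= (eq_sym j); case: (k == j); rewrite /= ?addnS ?addSn.
  by exists j; apply: leq_trans (le j); rewrite /mi_add_e eqxx.
Qed.

Lemma leibniz_ext F G F' G' l b g x y :
  (forall b, F b x = F' b y) -> (forall g, G g x = G' g y) ->
  leibniz F G l b g x = leibniz F' G' l b g y.
Proof. by move=> hF hG; elim: l b g => [|j l IH] b g /=; rewrite ?hF ?hG ?IH. Qed.

End LeibnizEval.

(** * The commutator at the centre of a test function *)

Definition theta_indep p q (c : 'I_q -> R) rho (f : point p q -> R) : Prop :=
  forall x y, domU c rho x -> rpart x = rpart y -> f x = f y.

(** An index in [mindex p q N] has total theta order at most [p * N], so the factor [(p * N).+1]
    lets one more derivative in r outweigh any loss in theta. *)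
Definition weight p q N (be : coord p q -> nat) : nat :=
  (\big[addn/O]_(i : 'I_p) be (inl i) + (p * N).+1 * \big[addn/O]_(j : 'I_q) be (inr j))%nat.

Lemma weight_lt p q N (al be : coord p q -> nat) k :
  (forall k, al k <= be k)%nat -> (al k < be k)%nat -> (weight N al < weight N be)%nat.
Proof.
rewrite /weight; case: k => [i|j] le lt.
  rewrite -addSn leq_add //; last by rewrite leq_mul // leq_sum.
  rewrite (bigD1 i) //= [leqRHS](bigD1 i) //= -addSn leq_add //.
  by apply: leq_sum.
rewrite -addnS leq_add //; first by apply: leq_sum.
rewrite ltn_mul2l /= (bigD1 j) //= [leqRHS](bigD1 j) //= -addSn leq_add //.
by apply: leq_sum.
Qed.

Lemma weight_lt_inr p q N (al be : coord p q -> nat) j :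
  (forall i, al (inl i) <= N)%nat -> (forall j, al (inr j) <= be (inr j))%nat ->
  (al (inr j) < be (inr j))%nat -> (weight N al < weight N be)%nat.
Proof.
move=> leN le lt; rewrite /weight.
have h1 : (\big[addn/O]_(i : 'I_p) al (inl i) <= p * N)%nat.
  apply: (@leq_trans (\big[addn/O]_(i : 'I_p) N)); first by apply: leq_sum.
  by rewrite big_const_ord iter_addn_0 mulnC.
have h2 : (\big[addn/O]_(j : 'I_q) al (inr j) < \big[addn/O]_(j : 'I_q) be (inr j))%nat.
  rewrite (bigD1 j) //= [leqRHS](bigD1 j) //= -addSn leq_add //.
  by apply: leq_sum.
apply: leq_trans (leq_addl _ _).
apply: leq_trans (leq_mul (leqnn _) h2).
by rewrite mulnS ltn_add2r ltnS.
Qed.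

Lemma derive_theta_indep p q (c : 'I_q -> R) rho (f : point p q -> R) D i x :
  is_deriv_family (domU c rho) f D -> theta_indep c rho f -> domU c rho x ->
  D (mi_e (inl i)) x = 0.
Proof.
move=> [D0 [_ dD]] fi Ux.
have h := dD mi0 (inl i) x Ux.
apply: (uniqueness_limite _ _ _ _ h).
have -> : (fun t => D mi0 (upd x (inl i) t)) = fct_cte (f x).
  apply: functional_extensionality => t.
  by rewrite D0 //; apply: esym; apply: fi.
exact: derivable_pt_lim_const.
Qed.

Section Commutator.
Variables (p q N : nat) (c : 'I_q -> R) (rho : R).
Variable a : 'I_p -> ('I_q -> R) -> R.
Variable C : mindex p q N -> point p q -> R.
Variable Da : 'I_p -> ('I_q -> nat) -> ('I_q -> R) -> R.
Variable DC : mindex p q N -> (coord p q -> nat) -> point p q -> R.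
Hypothesis hDa : forall i, is_deriv_family (in_ball c rho) (a i) (Da i).
Hypothesis hDC : forall al, is_deriv_family (domU c rho) (C al) (DC al).
Hypothesis commute : forall (f : point p q -> R) Df,
  theta_periodic c rho f -> is_deriv_family (domU c rho) f Df ->
  forall DZ, is_deriv_family (domU c rho) (applyZ a Df) DZ ->
  forall DL, is_deriv_family (domU c rho) (applyL C Df) DL ->
  forall x, domU c rho x -> applyZ a DL x = applyL C DZ x.

Variable al0 : mindex p q N.
Hypothesis indep_above :
  forall be : mindex p q N, (weight N (mi_of al0) < weight N (mi_of be))%nat -> theta_indep c rho (C be).

Let jet := test_jet (mi_of al0).
Let Df z := test_family (mi_of al0) z.
Let D_aidf z i := mul_family (@lift_family p q (Da i))
  (fun al => Df z (mi_add al (mi_e (inl i)))).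

(** The value at z of d^be (Z f) - Z (d^be f), where f is the test function centred at z. *)
Let defect z (be : mindex p q N) := \big[Rplus/R0]_(i : 'I_p)
  (D_aidf z i (mi_of be) z - a i (rpart z) * jet (mi_add (mi_e (inl i)) (mi_of be))).

Lemma defect_indep z z' be : rpart z = rpart z' -> defect z be = defect z' be.
Proof.
move=> e; apply: eq_bigr => i _; rewrite e; congr (_ - _).
apply: leibniz_ext => g; first by rewrite /lift_family e.
by rewrite /Df !test_family_center.
Qed.

(** The Leibniz term without a derivative on [a i] cancels. In any other nonzero term [a i] takes a
    derivative in r, while what is left still has at least the r-orders of [al0]; then [be] has more
    derivatives in r than [al0], hence a larger weight. *)
Lemma defect_vanish z (be : mindex p q N) : domU c rho z ->
  ~~ (weight N (mi_of al0) < weight N (mi_of be))%nat -> defect z be = 0.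
Proof.
move=> Uz nlt; apply: big1 => i _.
rewrite /D_aidf /mul_family leibniz_head.
  have -> : lift_family (Da i) mi0 z = a i (rpart z).
    by case: (@lift_family_is_family p _ _ _ _ _ (hDa i)) => ->.
  rewrite /Df test_family_center -/jet.
  set u := mi_add _ _; set v := mi_add _ _.
  have -> : u = v; last by ring.
  apply: functional_extensionality => k; rewrite /u /v /mi_add count_directions.
  by rewrite add0n addnC.
move=> b g e [k bk]; rewrite /Df test_family_center -/jet.
case: (classic (lift_family (Da i) b z = 0)) => [->|nb]; first by ring.
case: (classic (jet (mi_add g (mi_e (inl i))) = 0)) => [->|ng]; first by ring.
have b0 i' : b (inl i') = O.
  apply/eqP; move: nb; rewrite /lift_family; case: ifP => // /forallP h _.
  exact: h.
have le k' : (mi_of al0 k' <= mi_add g (mi_e (inl i)) k')%nat.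
  by rewrite leqNgt; apply/negP => /test_jet_vanish.
have ej j : (b (inr j) + g (inr j) = mi_of be (inr j))%nat.
  by rewrite e count_directions.
(* The additional derivative coming from Z is in a theta direction and adds nothing to the
   r-orders. *)
have le' j : (mi_of al0 (inr j) <= g (inr j))%nat.
  by move: (le (inr j)); rewrite /mi_add /= addn0.
case: k bk => [i'|j bj]; first by rewrite b0.
case/negP: nlt; apply: (@weight_lt_inr _ _ _ _ _ j) => [i'|j'|].
- by rewrite -ltnS; apply: ltn_ord.
- by rewrite -ej; apply: leq_trans (le' _) (leq_addl _ _).
- rewrite -ej; apply: leq_ltn_trans (le' _) _.
  by rewrite -[X in (X < _)%nat]add0n ltn_add2r.
Qed.

Lemma commutator_at_center z : domU c rho z ->
  (\big[Rplus/R0]_(i : 'I_p) (a i (rpart z) * DC al0 (mi_e (inl i)) z)) * jet (mi_of al0)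
  = \big[Rplus/R0]_(be : mindex p q N) (C be z * defect z be).
Proof.
move=> Uz.
have hDf := test_family_is_family (domU c rho) (mi_of al0) z; rewrite -/(Df z) in hDf.
have hDZ : is_deriv_family (domU c rho) (applyZ a (Df z))
    (fun al x => \big[Rplus/R0]_(i : 'I_p) D_aidf z i al x).
  apply: sum_family_is_family => i; apply: mul_family_is_family.
    exact: lift_family_is_family (hDa i).
  exact: shift_family_is_family hDf.
have hDL : is_deriv_family (domU c rho) (applyL C (Df z))
    (fun al x => \big[Rplus/R0]_(be : mindex p q N)
       mul_family (DC be) (fun al => Df z (mi_add al (mi_of be))) al x).
  apply: sum_family_is_family => be; apply: mul_family_is_family; first exact: hDC.
  exact: shift_family_is_family hDf.
have per : theta_periodic c rho (Df z mi0).
  by move=> x i _; apply: test_family_periodic.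
have := commute per hDf hDZ hDL Uz.
rewrite /applyZ /applyL => E.
(* [X] collects the terms where Z differentiates a coefficient, [Y] those where it differentiates
   d^be f. The [Y] part occurs on both sides and cancels. *)
pose X (be : mindex p q N) :=
  (\big[Rplus/R0]_(i : 'I_p) (a i (rpart z) * DC be (mi_e (inl i)) z)) * jet (mi_of be).
pose Y (be : mindex p q N) := C be z *
  \big[Rplus/R0]_(i : 'I_p) (a i (rpart z) * jet (mi_add (mi_e (inl i)) (mi_of be))).
have EL : \big[Rplus/R0]_(be : mindex p q N) X be + \big[Rplus/R0]_(be : mindex p q N) Y be
  = \big[Rplus/R0]_(be : mindex p q N) (C be z * defect z be)
    + \big[Rplus/R0]_(be : mindex p q N) Y be.
  rewrite -[RHS]big_split /=.
  have -> : \big[Rplus/R0]_(be : mindex p q N) (C be z * defect z be + Y be)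
    = \big[Rplus/R0]_(be : mindex p q N)
       (C be z * \big[Rplus/R0]_(i : 'I_p) D_aidf z i (mi_of be) z).
    apply: eq_bigr => be _; rewrite /Y -Rmult_plus_distr_l -big_split /=.
    by congr (_ * _); apply: eq_bigr => i _; ring.
  rewrite -E -big_split /=.
  under [RHS]eq_bigr => i _ do rewrite big_distrr /=.
  rewrite exchange_big /=; apply: eq_bigr => be _.
  rewrite /X /Y big_distrl big_distrr -big_split /=; apply: eq_bigr => i _.
  rewrite mul_family_e /Df !test_family_center -/jet.
  have -> : DC be mi0 z = C be z by case: (hDC be) => ->.
  have -> : mi_add mi0 (mi_of be) = mi_of be by exact: functional_extensionality.
  rewrite Rmult_plus_distr_l -!Rmult_assoc; congr (_ + _).
  by rewrite (Rmult_comm (C be z)).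
(* Only [X al0] survives: for another [be] either the jet vanishes, or [be] dominates [al0] in every
   entry; then it is heavier, its coefficient depends on r only and Z kills it. *)
rewrite -(Rplus_eq_reg_r _ _ _ EL) (bigD1 al0) //= [X in _ = _ + X]big1 ?Rplus_0_r // => be ne.
rewrite /X.
case: (classic (jet (mi_of be) = 0)) => [->|nj]; first by ring.
have le k : (mi_of al0 k <= mi_of be k)%nat.
  by rewrite leqNgt; apply/negP => /test_jet_vanish.
have [k lt] : exists k, (mi_of al0 k < mi_of be k)%nat.
  apply: NNPP => nex; move/eqP: ne; apply; apply/ffunP => k; apply/val_inj/eqP.
  rewrite eqn_leq [X in _ && X]le andbT leqNgt.
  by apply/negP => h; apply: nex; exists k.
have ind := indep_above (weight_lt N le lt).
rewrite big1 ?Rmult_0_l // => i _.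
by rewrite (derive_theta_indep i (hDC be) ind Uz) Rmult_0_r.
Qed.

(** In the commutator formula the heavier indices contribute functions of r, the others have zero
    defect, and the diagonal jet can be divided out. *)
Lemma Z_coeff_indep x y : domU c rho x -> rpart x = rpart y ->
  \big[Rplus/R0]_(i : 'I_p) (a i (rpart x) * DC al0 (mi_e (inl i)) x)
  = \big[Rplus/R0]_(i : 'I_p) (a i (rpart y) * DC al0 (mi_e (inl i)) y).
Proof.
move=> Ux e.
have Uy : domU c rho y by rewrite /domU -e.
apply: (Rmult_eq_reg_r (jet (mi_of al0))); last exact: test_jet_diag.
rewrite !commutator_at_center //; apply: eq_bigr => be _.
case: (boolP (weight N (mi_of al0) < weight N (mi_of be))%nat) => [lt|nlt].
  by rewrite (defect_indep be e) (indep_above lt Ux e).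
by rewrite !defect_vanish // !Rmult_0_r.
Qed.

End Commutator.

(** * Means of trigonometric polynomials along a linear flow *)

Lemma Rsum_lin (I : finType) (x y : R) (f g : I -> R) :
  \big[Rplus/R0]_i (x * f i + y * g i)
  = x * \big[Rplus/R0]_i f i + y * \big[Rplus/R0]_i g i.
Proof. by rewrite big_split /= !big_distrr. Qed.

Lemma Rsum_le (I : Type) (l : seq I) (P : pred I) (f g : I -> R) :
  (forall i, P i -> f i <= g i) ->
  \big[Rplus/R0]_(i <- l | P i) f i <= \big[Rplus/R0]_(i <- l | P i) g i.
Proof.
move=> h; apply: (big_ind2 Rle) => //; first exact: Rle_refl.
by move=> *; apply: Rplus_le_compat.
Qed.

Lemma Rsum_const_ord n (x : R) : \big[Rplus/R0]_(i : 'I_n) x = INR n * x.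
Proof.
elim: n => [|n IH]; first by rewrite big_ord0 /= Rmult_0_l.
rewrite big_ord_recl IH S_INR; ring.
Qed.

Definition zdot p (k : 'I_p -> Z) (th : 'I_p -> R) : R :=
  \big[Rplus/R0]_(i : 'I_p) (IZR (k i) * th i).

Section TorusMean.
Variables (p : nat) (v : 'I_p -> R).
Implicit Types (u w W : ('I_p -> R) -> R) (th : 'I_p -> R) (l : seq R).

Definition translate (t : R) th : 'I_p -> R := fun i => th i + t * v i.

Definition flow_invariant w := forall t th, w (translate t th) = w th.

(** The mean of [u] over the translates by all subset sums of the times in [l]. *)
Fixpoint avg l u th : R :=
  if l is t :: l' then (avg l' u th + avg l' u (translate t th)) / 2 else u th.

(* Averaging over a well-chosen finite set of flow times replaces the mean of a trigonometric polynomial over the torus. *)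
Definition has_mean u W := flow_invariant W /\ exists l, forall th, avg l u th = W th.

Lemma translateC s t th : translate s (translate t th) = translate t (translate s th).
Proof. by apply: functional_extensionality => i; rewrite /translate; ring. Qed.

(** Flow-invariant coefficients act as scalars, since averaging only moves points along the flow. *)
Lemma avg_lin l u1 u2 w1 w2 th : flow_invariant w1 -> flow_invariant w2 ->
  avg l (fun th => w1 th * u1 th + w2 th * u2 th) th
  = w1 th * avg l u1 th + w2 th * avg l u2 th.
Proof. by move=> h1 h2; elim: l th => [//|t l IH] th /=; rewrite !IH h1 h2; field. Qed.

Lemma flow_invariant_const d : flow_invariant (fun _ => d).
Proof. by []. Qed.

Lemma avg_translate l u s th :
  avg l (fun th => u (translate s th)) th = avg l u (translate s th).
Proof. by elim: l th => [//|t l IH] th /=; rewrite !IH translateC. Qed.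

Lemma avg_cat l1 l2 u th : avg (l1 ++ l2) u th = avg l1 (avg l2 u) th.
Proof. by elim: l1 th => [//|t l IH] th /=; rewrite !IH. Qed.

Lemma avgC l1 l2 u th : avg l1 (avg l2 u) th = avg l2 (avg l1 u) th.
Proof.
elim: l1 th => [//|t l IH] th; rewrite [LHS]/= !IH.
have -> : avg (t :: l) u = fun th => / 2 * avg l u th + / 2 * avg l u (translate t th).
  by apply: functional_extensionality => th' /=; field.
by rewrite (avg_lin l2 _ (fun th => avg l u (translate t th))) // avg_translate; field.
Qed.

Lemma avg_invariant l w th : flow_invariant w -> avg l w th = w th.
Proof. by move=> h; elim: l th => [//|t l IH] th /=; rewrite !IH h; field. Qed.

(** The list [l1 ++ l2] serves both functions: the two averages commute, each sends its own function
    to its mean, and the other one fixes that mean by invariance. *)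
Lemma has_mean_lin u1 W1 u2 W2 w1 w2 :
  flow_invariant w1 -> flow_invariant w2 -> has_mean u1 W1 -> has_mean u2 W2 ->
  has_mean (fun th => w1 th * u1 th + w2 th * u2 th)
    (fun th => w1 th * W1 th + w2 th * W2 th).
Proof.
move=> i1 i2 [j1 [l1 e1]] [j2 [l2 e2]]; split.
  by move=> t th; rewrite i1 i2 j1 j2.
exists (l1 ++ l2) => th; rewrite avg_lin // !avg_cat avgC.
have -> : avg l1 u1 = W1 by exact: functional_extensionality.
have -> : avg l2 u2 = W2 by exact: functional_extensionality.
by rewrite !avg_invariant.
Qed.

Lemma has_mean_sum (I : Type) (s : seq I) (u : I -> ('I_p -> R) -> R) (W : I -> R) :
  (forall i, has_mean (u i) (fun _ => W i)) ->
  has_mean (fun th => \big[Rplus/R0]_(i <- s) u i th)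
    (fun _ => \big[Rplus/R0]_(i <- s) W i).
Proof.
move=> h; elim: s => [|i s IH].
  by split=> //; exists [::] => th /=; rewrite !big_nil.
have [_ [l e]] := has_mean_lin (flow_invariant_const 1) (flow_invariant_const 1) (h i) IH.
split=> //; exists l => th; rewrite big_cons.
have -> : (fun th => \big[Rplus/R0]_(j <- i :: s) u j th)
  = fun th => 1 * u i th + 1 * \big[Rplus/R0]_(j <- s) u j th.
  by apply: functional_extensionality => th'; rewrite big_cons; ring.
by rewrite e; ring.
Qed.

Lemma has_mean_ge0 u W th : has_mean u W -> (forall th, 0 <= u th) -> 0 <= W th.
Proof.
move=> [_ [l <-]] h; elim: l th => [//|t l IH] th /=.
by have := IH th; have := IH (translate t th); lra.
Qed.

Lemma zdot_translate k t th : zdot k (translate t th) = zdot k th + t * zdot k v.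
Proof.
rewrite /zdot big_distrr -big_split /=; apply: eq_bigr => i _.
by rewrite /translate; ring.
Qed.

(** The mean of cos (2 pi k . th) over the torus. *)
Definition zvanish (k : 'I_p -> Z) : R :=
  if [forall i, Z.eqb (k i) 0] then 1 else 0.

Lemma has_mean_cos k : ((exists i, k i <> 0%Z) -> zdot k v <> 0) ->
  has_mean (fun th => cos (2 * PI * zdot k th)) (fun _ => zvanish k).
Proof.
move=> hk; split=> //; rewrite /zvanish; case: ifP => [/forallP k0|nk].
  exists [::] => th /=; rewrite /zdot big1 ?Rmult_0_r ?cos_0 // => i _.
  by move/Z.eqb_eq: (k0 i) => ->; rewrite Rmult_0_l.
have kv : zdot k v <> 0.
  apply: hk; apply: NNPP => nex; move/negP: nk; apply.
  apply/forallP => i; apply/Z.eqb_eq; apply: NNPP => ki.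
  by apply: nex; exists i.
(* This time shifts the phase by pi, so the two cosines cancel. *)
exists [:: / (2 * zdot k v)] => th /=; rewrite zdot_translate.
have -> : 2 * PI * (zdot k th + / (2 * zdot k v) * zdot k v) = 2 * PI * zdot k th + PI.
  by field.
by rewrite neg_cos; field.
Qed.

(** * The Fejer kernel and its product with a shifted mode *)

Section Fejer.
Variable n : nat.
Let G := {ffun 'I_p -> 'I_n.+1}.

Definition freq (m m' : G) (i : 'I_p) : Z :=
  (Z.of_nat (m i) - Z.of_nat (m' i))%Z.
Definition freq_e (j : 'I_p) (m m' : G) (i : 'I_p) : Z :=
  (freq m m' i + if i == j then 1 else 0)%Z.

Let X (th : 'I_p -> R) (m : G) : R :=
  2 * PI * \big[Rplus/R0]_(i : 'I_p) (INR (m i) * th i).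

Lemma zdot_freq th m m' : 2 * PI * zdot (freq m m') th = X th m - X th m'.
Proof.
rewrite /X -Rmult_minus_distr_l; congr (_ * _).
apply: (Rplus_eq_reg_r (\big[Rplus/R0]_(i : 'I_p) (INR (m' i) * th i))).
have -> : forall a b, a - b + b = a by move=> *; ring.
rewrite /zdot -big_split /=; apply: eq_bigr => i _.
by rewrite /freq minus_IZR -!INR_IZR_INZ; ring.
Qed.

Lemma zdot_freq_e th j m m' :
  2 * PI * zdot (freq_e j m m') th = X th m - X th m' + 2 * PI * th j.
Proof.
rewrite -zdot_freq -Rmult_plus_distr_l; congr (_ * _).
have -> : th j = \big[Rplus/R0]_(i : 'I_p) (if i == j then th i else 0).
  by rewrite -big_mkcond big_pred1_eq.
rewrite /zdot -big_split /=; apply: eq_bigr => i _.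
by rewrite /freq_e plus_IZR; case: eqP => _; ring.
Qed.

(** The unnormalised Fejer kernel, as the squared modulus of the sum of exp (i [X th m]). *)
Let Q th := (\big[Rplus/R0]_(m : G) cos (X th m)) ^ 2 + (\big[Rplus/R0]_(m : G) sin (X th m)) ^ 2.

(** The double sum is the real part of exp (i h) times that squared modulus. *)
Lemma fejer_shift th h :
  \big[Rplus/R0]_(m : G) \big[Rplus/R0]_(m' : G) cos (X th m - X th m' + h) = cos h * Q th.
Proof.
set Cs := \big[Rplus/R0]_(m : G) cos (X th m); set Sn := \big[Rplus/R0]_(m : G) sin (X th m).
transitivity (\big[Rplus/R0]_(m : G)
    ((cos h * Cs + sin h * Sn) * cos (X th m) + (cos h * Sn - sin h * Cs) * sin (X th m))).
  apply: eq_bigr => m _.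
  transitivity (\big[Rplus/R0]_(m' : G)
      (cos (X th m + h) * cos (X th m') + sin (X th m + h) * sin (X th m'))).
    apply: eq_bigr => m' _; rewrite -cos_minus; congr cos; ring.
  rewrite Rsum_lin -/Cs -/Sn cos_plus sin_plus; ring.
rewrite Rsum_lin -/Cs -/Sn /Q -/Cs -/Sn; ring.
Qed.

Lemma sum_zvanish_freq :
  \big[Rplus/R0]_(m : G) \big[Rplus/R0]_(m' : G) zvanish (freq m m') = \big[Rplus/R0]_(m : G) 1.
Proof.
apply: eq_bigr => m _; rewrite (bigD1 m) //= big1 => [|m' ne].
  rewrite Rplus_0_r /zvanish; case: forallP => // h; case: h => i.
  by apply/Z.eqb_eq; rewrite /freq Z.sub_diag.
rewrite /zvanish; case: ifP => // /forallP h; case/eqP: ne.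
apply/ffunP => i; apply/val_inj => /=; move/Z.eqb_eq: (h i); rewrite /freq; lia.
Qed.

(** A zero frequency comes from m' = m + e_j, which exists unless m_j = n; this exception concerns
    one m out of every n + 1. *)
Lemma sum_zvanish_freq_e j : INR n.+1 * \big[Rplus/R0]_(m : G) 1
  <= INR n.+1 * \big[Rplus/R0]_(m : G) \big[Rplus/R0]_(m' : G) zvanish (freq_e j m m')
     + \big[Rplus/R0]_(m : G) 1.
Proof.
have z0 k : 0 <= zvanish k by rewrite /zvanish; case: ifP => _; lra.
have low : \big[Rplus/R0]_(m : G) 1 <=
  \big[Rplus/R0]_(m : G) \big[Rplus/R0]_(m' : G) zvanish (freq_e j m m')
  + \big[Rplus/R0]_(m : G) (if m j == ord_max then 1 else 0).
  rewrite -big_split /=; apply: Rsum_le => m _.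
  have pos : 0 <= \big[Rplus/R0]_(m' : G) zvanish (freq_e j m m').
    apply: (big_ind (fun r => 0 <= r)) => [|x y|m' _]; [lra | lra | exact: z0].
  case: eqP => [_|ne]; first by rewrite -{1}[1]Rplus_0_l; apply: Rplus_le_compat_r.
  have lt : ((m j).+1 < n.+1)%nat.
    rewrite ltn_neqAle ltn_ord andbT; apply/eqP => e; apply: ne.
    by apply: val_inj => /=; case: e.
  rewrite (bigD1 [ffun i => if i == j then Ordinal lt else m i]) //=.
  have -> : zvanish (freq_e j m [ffun i => if i == j then Ordinal lt else m i]) = 1.
    rewrite /zvanish; case: forallP => // h; case: h => i.
    apply/Z.eqb_eq; rewrite /freq_e /freq ffunE; case: eqP => [->|_] /=; lia.
  set s := \big[_/_]_(_ | _) _; suff : 0 <= s by lra.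
  apply: (big_ind (fun r => 0 <= r)) => [|x y|m' _]; [lra | lra | exact: z0].
suff e : INR n.+1 * \big[Rplus/R0]_(m : G) (if m j == ord_max then 1 else 0)
         = \big[Rplus/R0]_(m : G) 1.
  have n0 := pos_INR n.+1.
  by have := Rmult_le_compat_l _ _ _ n0 low; rewrite Rmult_plus_distr_l e.
(* The exceptional m are counted by factoring sums over [G] into products over the coordinates. *)
have prodE (F : 'I_p -> 'I_n.+1 -> R) :=
  @bigA_distr_bigA R R0 R1 Rmult Rplus 'I_p 'I_n.+1 F.
have -> : \big[Rplus/R0]_(m : G) 1 = \big[Rmult/R1]_(i : 'I_p) \big[Rplus/R0]_(k : 'I_n.+1) 1.
  by rewrite (prodE (fun _ _ => 1)); apply: eq_bigr => m _; rewrite big1.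
have -> : \big[Rplus/R0]_(m : G) (if m j == ord_max then 1 else 0)
  = \big[Rmult/R1]_(i : 'I_p) \big[Rplus/R0]_(k : 'I_n.+1)
      (if i == j then if k == ord_max then 1 else 0 else 1).
  rewrite (prodE (fun i k => if i == j then if k == ord_max then 1 else 0 else 1)).
  apply: eq_bigr => m _; rewrite (bigD1 j) //= eqxx big1 ?Rmult_1_r // => i ne.
  by rewrite (negbTE ne).
rewrite (bigD1 j) //= [RHS](bigD1 j) //= eqxx -big_mkcond big_pred1_eq Rsum_const_ord.
rewrite Rmult_1_l Rmult_1_r; congr (_ * _); apply: eq_bigr => i ne.
by rewrite (negbTE ne) Rsum_const_ord; ring.
Qed.

(* The weight 1 - cos (2 pi th_j) has mean 1/(n+1) against the normalised Fejer kernel. *)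
Lemma fejer_mean_ge0 w (B : R) th : 0 <= B -> flow_invariant w ->
  (forall k, (exists i, k i <> 0%Z) -> (forall i, Z.abs (k i) <= Z.of_nat n.+1)%Z ->
     zdot k v <> 0) ->
  (forall th, 0 <= w th + B * \big[Rplus/R0]_(j : 'I_p) (1 - cos (2 * PI * th j))) ->
  0 <= w th + B * INR p / INR n.+1.
Proof.
move=> B0 wi gen pos.
have Q0 th' : 0 <= Q th' by rewrite /Q; nra.
have small (m : G) i : (0 <= Z.of_nat (m i) <= Z.of_nat n)%Z.
  by have /leP := ltn_ord (m i); lia.
have h1 : has_mean (fun th => \big[Rplus/R0]_(m : G) \big[Rplus/R0]_(m' : G)
    cos (2 * PI * zdot (freq m m') th)) (fun _ => \big[Rplus/R0]_(m : G) 1).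
  rewrite -sum_zvanish_freq; apply: has_mean_sum => m; apply: has_mean_sum => m'.
  apply: has_mean_cos => ex; apply: gen ex _ => i.
  have := small m i; have := small m' i; rewrite /freq; lia.
(* The shifted frequencies reach size n + 1, one beyond the degree of the kernel. *)
have h2 : has_mean (fun th => \big[Rplus/R0]_(j : 'I_p) \big[Rplus/R0]_(m : G)
    \big[Rplus/R0]_(m' : G) cos (2 * PI * zdot (freq_e j m m') th))
  (fun _ => \big[Rplus/R0]_(j : 'I_p) \big[Rplus/R0]_(m : G) \big[Rplus/R0]_(m' : G)
    zvanish (freq_e j m m')).
  apply: has_mean_sum => j; apply: has_mean_sum => m; apply: has_mean_sum => m'.
  apply: has_mean_cos => ex; apply: gen ex _ => i.
  have := small m i; have := small m' i; rewrite /freq_e /freq; case: (i == j); lia.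
have wi' : flow_invariant (fun th => w th + B * INR p) by move=> t th'; rewrite wi.
(* The nonnegative function is [Q] times the expression in the hypothesis, with the sum of 1 - cos
   split as p minus the sum of cosines; its mean is a combination of [A] and [S]. *)
have := has_mean_ge0 th (has_mean_lin wi' (flow_invariant_const (- B)) h1 h2).
set A := \big[Rplus/R0]_(m : G) 1; set S := \big[Rplus/R0]_(j : 'I_p) _ => H.
have {}H : 0 <= (w th + B * INR p) * A + - B * S.
  apply: H => th'.
  have -> : \big[Rplus/R0]_(m : G) \big[Rplus/R0]_(m' : G) cos (2 * PI * zdot (freq m m') th') = Q th'.
    transitivity (cos 0 * Q th'); last by rewrite cos_0 Rmult_1_l.
    rewrite -(fejer_shift th' 0).
    by apply: eq_bigr => m _; apply: eq_bigr => m' _; rewrite zdot_freq Rplus_0_r.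
  have -> : \big[Rplus/R0]_(j : 'I_p) \big[Rplus/R0]_(m : G) \big[Rplus/R0]_(m' : G)
      cos (2 * PI * zdot (freq_e j m m') th')
    = Q th' * \big[Rplus/R0]_(j : 'I_p) cos (2 * PI * th' j).
    rewrite big_distrr; apply: eq_bigr => j _; rewrite [RHS]Rmult_comm -(fejer_shift th' (2 * PI * th' j)).
    by apply: eq_bigr => m _; apply: eq_bigr => m' _; rewrite zdot_freq_e.
  have := Rmult_le_pos _ _ (Q0 th') (pos th').
  have -> : \big[Rplus/R0]_(j : 'I_p) (1 - cos (2 * PI * th' j))
    = INR p + -1 * \big[Rplus/R0]_(j : 'I_p) cos (2 * PI * th' j).
    rewrite -[INR p]Rmult_1_l -[1 * INR p]Rmult_comm -Rsum_const_ord -[\big[_/_]_(_ < _) 1]Rmult_1_l.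
    by rewrite -Rsum_lin; apply: eq_bigr => j _; ring.
  by move=> h; apply: (Rle_trans _ _ _ h); apply: Req_le; ring.
have A0 : 0 < A.
  rewrite /A (bigD1 [ffun=> ord0]) //=.
  set s := \big[_/_]_(_ | _) _; suff : 0 <= s by lra.
  by apply: (big_ind (fun r => 0 <= r)) => [|x y|m' _]; lra.
have n0 : 0 < INR n.+1 by apply: lt_0_INR; lia.
have SA : INR n.+1 * (INR p * A) <= INR n.+1 * S + INR p * A.
  have -> : INR n.+1 * (INR p * A) = \big[Rplus/R0]_(j : 'I_p) (INR n.+1 * A).
    by rewrite Rsum_const_ord; ring.
  have -> : INR n.+1 * S + INR p * A = \big[Rplus/R0]_(j : 'I_p)
     (INR n.+1 * \big[Rplus/R0]_(m : G) \big[Rplus/R0]_(m' : G) zvanish (freq_e j m m') + A).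
    by rewrite big_split -big_distrr Rsum_const_ord.
  by apply: Rsum_le => j _; exact: sum_zvanish_freq_e.
apply: (Rmult_le_reg_r (A * INR n.+1)); first by nra.
rewrite Rmult_0_l.
have -> : (w th + B * INR p / INR n.+1) * (A * INR n.+1)
  = INR n.+1 * ((w th + B * INR p) * A + - B * S)
    + B * (INR n.+1 * S + INR p * A - INR n.+1 * (INR p * A)).
  by field; lra.
apply: Rplus_le_le_0_compat; apply: Rmult_le_pos => //; lra.
Qed.

End Fejer.
End TorusMean.

(** * Derivatives along lines *)

Lemma open_cont_pos (T : finType) (V : (T -> R) -> Prop) (g : (T -> R) -> R) :
  Defs.open_set V -> cont_on V g -> Defs.open_set (fun x => V x /\ 0 < g x).
Proof.
move=> oV cg x [Vx gx].
have [e [e0 he]] := oV x Vx; have [d [d0 hd]] := cg x Vx _ gx.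
exists (Rmin e d); split; first exact: Rmin_Rgt_r.
move=> y yx.
have Vy : V y by apply: he => k; apply: Rlt_le_trans (yx k) (Rmin_l _ _).
split=> //.
have := hd y Vy (fun k => Rlt_le_trans _ _ _ (yx k) (Rmin_r _ _)).
by split_Rabs; lra.
Qed.

Lemma open_in_ball q (c : 'I_q -> R) rho : Defs.open_set (in_ball c rho).
Proof.
pose g (r : 'I_q -> R) :=
  rho * rho + -1 * \big[Rplus/R0]_(j : 'I_q) ((r j - c j) * (r j - c j)).
have cg : cont_on (fun _ => True) g.
  apply: cont_on_add; first exact: cont_on_const.
  apply: cont_on_mul; first exact: cont_on_const.
  apply: cont_on_sum => j.
  apply: (@cont_on_coord _ _ j (fun u => (u - c j) * (u - c j))).
  by move=> u; reg.
have oT : Defs.open_set (fun _ : 'I_q -> R => True) by move=> x _; exists 1; split=> //; lra.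
move=> r; rewrite /in_ball => hr.
have [|e [e0 he]] := open_cont_pos oT cg (x := r).
  by split=> //; rewrite /g; lra.
by exists e; split=> // y /he [_]; rewrite /g /in_ball; lra.
Qed.

Lemma open_domU p q (c : 'I_q -> R) rho : Defs.open_set (@domU p q c rho).
Proof.
move=> x /open_in_ball [e [e0 he]]; exists e; split=> // y yx.
by apply: he => j; apply: yx.
Qed.

Lemma derivable_pt_lim_upd (T : finType) (U : (T -> R) -> Prop) D (y : T -> R) k u :
  is_family U D -> U (upd y k u) ->
  derivable_pt_lim (fun u => D mi0 (upd y k u)) u (D (mi_e k) (upd y k u)).
Proof.
move=> [_ [_ dD]] Uu; have := dD mi0 k _ Uu; rewrite {3}/upd eqxx.
congr derivable_pt_lim; apply: functional_extensionality => t; congr (D _ _).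
by apply: functional_extensionality => i; rewrite /upd; case: (i == k).
Qed.

(** The chain rule from continuous partial derivatives: coordinates are set in motion one at a time,
    and the mean value theorem controls each new one. *)
Lemma derivative_along_line (T : finType) (U : (T -> R) -> Prop) D x (w : T -> R) :
  Defs.open_set U -> is_family U D -> U x ->
  derivable_pt_lim (fun t => D mi0 (fun k => x k + t * w k)) 0
    (\big[Rplus/R0]_(k : T) (w k * D (mi_e k) x)).
Proof.
move=> oU hD Ux; have [_ [cD _]] := hD.
pose line (s : seq T) t : T -> R := fun k => x k + (if k \in s then t * w k else 0).
suff main s : uniq s -> derivable_pt_lim (fun t => D mi0 (line s t)) 0
    (\big[Rplus/R0]_(k <- s) (w k * D (mi_e k) x)).
  have := main _ (index_enum_uniq T); congr derivable_pt_lim.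
  apply: functional_extensionality => t; congr (D _ _).
  by apply: functional_extensionality => k; rewrite /line mem_index_enum.
(* The added 1 keeps [K] positive and makes the final estimate strict. *)
pose K := \big[Rplus/R0]_(k : T) Rabs (w k) + 1.
have wK k : Rabs (w k) <= K - 1.
  rewrite /K (bigD1 k) //=; set s' := \big[_/_]_(_ | _) _; suff : 0 <= s' by lra.
  apply: (big_ind (fun r => 0 <= r)) => [|a b|i _]; [lra | lra | exact: Rabs_pos].
have K0 : 0 < K.
  rewrite /K; suff : 0 <= \big[Rplus/R0]_(k : T) Rabs (w k) by lra.
  apply: (big_ind (fun r => 0 <= r)) => [|a b|i _]; [lra | lra | exact: Rabs_pos].
elim: s => [_|k s IH /= /andP[ks us]].
  rewrite big_nil.
  have -> : (fun t => D mi0 (line [::] t)) = fct_cte (D mi0 x).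
    apply: functional_extensionality => t; congr (D _ _).
    by apply: functional_extensionality => k; rewrite /line /=; ring.
  exact: derivable_pt_lim_const.
move=> e e0; rewrite big_cons.
have e2 : 0 < e / 2 by lra.
have [[d1 d10] h1] := IH us _ e2.
set L := D (mi_e k) x.
have eta0 : e / (2 * K) > 0 by apply: Rdiv_lt_0_compat; lra.
have [d2 [d20 h2]] := cD (mi_e k) x Ux _ eta0.
have [d3 [d30 h3]] := oU x Ux.
have dK : 0 < Rmin d2 d3 / K.
  by apply: Rdiv_lt_0_compat => //; apply: Rmin_glb_lt.
have d0 : 0 < Rmin d1 (Rmin d2 d3 / K) by apply: Rmin_glb_lt.
exists (mkposreal _ d0) => t t0 /= td.
have td1 := Rlt_le_trans _ _ _ td (Rmin_l _ _).
have tdK : Rabs t * K < Rmin d2 d3.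
  have := Rmult_lt_compat_r _ _ _ K0 (Rlt_le_trans _ _ _ td (Rmin_r _ _)).
  by have -> : Rmin d2 d3 / K * K = Rmin d2 d3 by field; lra.
have := h1 t t0 td1; rewrite /= !Rplus_0_l => {}h1.
have line0 s' : line s' 0 = x.
  by apply: functional_extensionality => i; rewrite /line; case: ifP => _; ring.
move: h1; rewrite !line0 => h1.
have close i : Rabs (t * w i) < Rmin d2 d3.
  apply: Rle_lt_trans tdK; rewrite Rabs_mult; apply: Rmult_le_compat_l; first exact: Rabs_pos.
  by have := wK i; lra.
set y := line s t.
have yk : y k = x k by rewrite /y /line (negbTE ks); ring.
have lineE : line (k :: s) t = upd y k (x k + t * w k).
  apply: functional_extensionality => i; rewrite /y /line /upd in_cons.
  by case: eqP => [->|].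
have near u i : Rmin (x k) (x k + t * w k) <= u <= Rmax (x k) (x k + t * w k) ->
    Rabs (upd y k u i - x i) < Rmin d2 d3.
  move=> hu; rewrite /upd /y /line; have M0 : 0 < Rmin d2 d3 by apply: Rmin_glb_lt.
  case: eqP => [->|_].
    apply: Rle_lt_trans (close k); move: hu; rewrite /Rmin /Rmax.
    by case: Rle_dec => ?; split_Rabs; lra.
  case: ifP => _; last by rewrite Rplus_0_r Rminus_diag Rabs_R0.
  by have -> : x i + t * w i - x i = t * w i by ring.
(* Subtracting the linear function of slope [L] makes the mean value theorem bound the error
   directly, by the oscillation of the partial derivative near x. *)
have der u : Rmin (x k) (x k + t * w k) <= u <= Rmax (x k) (x k + t * w k) ->
    derivable_pt_lim (fun u => D mi0 (upd y k u) - L * u) u (D (mi_e k) (upd y k u) - L * 1).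
  move=> hu; apply: derivable_pt_lim_minus; last exact: derivable_pt_lim_scal (derivable_pt_lim_id u).
  apply: (derivable_pt_lim_upd hD).
  by apply: h3 => i; apply: Rlt_le_trans (near u i hu) (Rmin_r _ _).
have [u [Eu [lu1 lu2]]] := MVT_abs _ _ _ _ der.
have nu i := Rlt_le_trans _ _ _ (near u i (conj lu1 lu2)).
have Uu : U (upd y k u) by apply: h3 => i; exact: nu _ _ (Rmin_r _ _).
have := h2 _ Uu (fun i => nu _ i (Rmin_l _ _)); rewrite -/L => small.
have updy : upd y k (x k) = y.
  by apply: functional_extensionality => i; rewrite /upd; case: eqP => [->|].
move: Eu; rewrite lineE updy.
set P := D mi0 (upd y k (x k + t * w k)); set Q := D mi0 y.
have -> : P - L * (x k + t * w k) - (Q - L * x k) = P - Q - t * (w k * L) by ring.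
have -> : x k + t * w k - x k = t * w k by ring.
rewrite Rmult_1_r Rabs_mult => Eu.
have tp : 0 < Rabs t by exact: Rabs_pos_lt.
have step : Rabs ((P - Q) / t - w k * L) < e / 2.
  apply: (Rmult_lt_reg_l (Rabs t)) => //; rewrite -Rabs_mult.
  have -> : t * ((P - Q) / t - w k * L) = P - Q - t * (w k * L) by field.
  rewrite Eu.
  apply: (Rle_lt_trans _ (e / (2 * K) * (Rabs t * (K - 1)))).
    apply: Rmult_le_compat; [exact: Rabs_pos | | exact: Rlt_le | ].
      by apply: Rmult_le_pos; exact: Rabs_pos.
    by apply: Rmult_le_compat_l; [lra | exact: wK].
  have -> : e / (2 * K) * (Rabs t * (K - 1)) = Rabs t * (e / 2) * (1 - / K) by field; lra.
  have iK : 0 < / K by exact: Rinv_0_lt_compat.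
  have pp : 0 < Rabs t * (e / 2) by apply: Rmult_lt_0_compat; lra.
  nra.
move: h1; rewrite -/y -/Q; set S := \big[_/_]_(_ <- _) _ => h1.
have -> : (P - D mi0 x) / t - (w k * L + S)
  = ((P - Q) / t - w k * L) + ((Q - D mi0 x) / t - S) by field.
by apply: Rle_lt_trans (Rabs_triang _ _) _; lra.
Qed.

(** * From flow invariance to independence of theta *)

Definition mkpoint p q (th : 'I_p -> R) (r : 'I_q -> R) : point p q :=
  fun k => match k with inl i => th i | inr j => r j end.

Definition tpart p q (x : point p q) : 'I_p -> R := fun i => x (inl i).

Lemma periodic_int p q (c : 'I_q -> R) rho (f : point p q -> R) x i z :
  theta_periodic c rho f -> domU c rho x ->
  f (upd x (inl i) (x (inl i) + IZR z)) = f x.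
Proof.
move=> per Ux.
have nat_case y n : domU c rho y -> f (upd y (inl i) (y (inl i) + INR n)) = f y.
  move=> Uy; elim: n => [|n IH].
    congr f; apply: functional_extensionality => k; rewrite /upd /=.
    by case: eqP => [->|//]; rewrite Rplus_0_r.
  rewrite -IH S_INR.
  have Uy' : domU c rho (upd y (inl i) (y (inl i) + INR n)) by [].
  rewrite -[RHS](per _ i Uy'); congr f; apply: functional_extensionality => k.
  by rewrite /upd eqxx; case: (k == inl i) => //; ring.
case: (Z_le_gt_dec 0 z) => hz.
  by rewrite -(Z2Nat.id z hz) -INR_IZR_INZ nat_case.
rewrite -(nat_case (upd x (inl i) (x (inl i) + IZR z)) (Z.to_nat (- z))) //.
congr f; apply: functional_extensionality => k; rewrite /upd eqxx.
case: eqP => [->|//]; rewrite INR_IZR_INZ Z2Nat.id; last lia.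
by rewrite opp_IZR; ring.
Qed.

Lemma periodic_lattice p q (c : 'I_q -> R) rho (f : point p q -> R) th r (z : 'I_p -> Z) :
  theta_periodic c rho f -> in_ball c rho r ->
  f (mkpoint (fun i => th i + IZR (z i)) r) = f (mkpoint th r).
Proof.
move=> per Ur.
pose pt (s : seq 'I_p) := mkpoint (fun i => th i + if i \in s then IZR (z i) else 0) r.
have main s : uniq s -> f (pt s) = f (mkpoint th r).
  elim: s => [_|i s IH /= /andP[js us]].
    by congr f; congr mkpoint; apply: functional_extensionality => i; rewrite Rplus_0_r.
  rewrite -IH // -(periodic_int i (z i) per (x := pt s) Ur); congr f.
  apply: functional_extensionality => -[j|j] //.
  rewrite /upd /pt /= in_cons.
  have -> : (inl j == inl i :> 'I_p + 'I_q) = (j == i) by [].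
  by case: eqP => [->|//]; rewrite (negbTE js) Rplus_0_r.
rewrite -(main _ (index_enum_uniq 'I_p)); congr f; congr mkpoint.
by apply: functional_extensionality => i; rewrite mem_index_enum.
Qed.

(** Supremum argument: the set of t with a uniform constant on [0, t] has a least upper bound s, and
    the local constant at s carries past it. Monotonicity merges the two constants. *)
Lemma unit_interval_compact (good : R -> R -> Prop) :
  (forall u K K', K <= K' -> good u K -> good u K') ->
  (forall u, exists K d, 0 < d /\ forall u', Rabs (u' - u) < d -> good u' K) ->
  exists K, forall u, 0 <= u <= 1 -> good u K.
Proof.
move=> mono loc.
pose E t := 0 <= t <= 1 /\ exists K, forall u, 0 <= u <= t -> good u K.
have E0 : E 0.
  split; first lra.
  have [K [d [d0 h]]] := loc 0; exists K => u hu; apply: h.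
  have -> : u - 0 = 0 by lra.
  by rewrite Rabs_R0.
have [s [ub lub]] : {s | is_lub E s}.
  by apply: completeness; [exists 1 => t [] [] | exists 0].
have s0 : 0 <= s by exact: ub.
have s1 : s <= 1 by apply: lub => t [] [].
have [K [d [d0 h]]] := loc s.
have [t [[t01 [K' h']] ts]] : exists t, E t /\ s - d < t.
  apply: NNPP => nex; suff : s <= s - d by lra.
  by apply: lub => t Et; apply: Rnot_lt_le => lt; apply: nex; exists t.
have ext u : 0 <= u -> u < s + d -> good u (Rmax K K').
  move=> u0 us; case: (Rle_dec u t) => ut.
    by apply: mono (Rmax_r _ _) _; apply: h'.
  by apply: mono (Rmax_l _ _) _; apply: h; apply: Rabs_def1; lra.
exists (Rmax K K') => u hu; apply: (ext); first lra.
(* If s + d were at most 1, then s + d / 2 would lie in [E] beyond its supremum. *)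
suff : 1 < s + d by lra.
apply: Rnot_le_lt => le; suff : s + d / 2 <= s by lra.
apply: ub; split; first lra.
by exists (Rmax K K') => v hv; apply: ext; lra.
Qed.

(** Interval compactness is applied to one theta coordinate at a time, and periodicity then reaches
    every [th]. *)
Lemma locally_bounded_on_torus p q (c : 'I_q -> R) rho (f : point p q -> R) r :
  theta_periodic c rho f -> cont_on (domU c rho) f -> in_ball c rho r ->
  exists K, 0 < K /\ forall th r', (forall j, Rabs (r' j - r j) < / K) ->
    Rabs (f (mkpoint th r')) <= K.
Proof.
move=> per cf Ur.
(* The coordinates in [s] range over [0, 1], the others stay near x. [K] is both the bound and the
   inverse radius, which makes [good] monotone in [K]. *)
pose good (s : seq 'I_p) (x : point p q) K := 0 < K /\ forall y : point p q,
  (forall i, i \notin s -> Rabs (y (inl i) - x (inl i)) < / K) ->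
  (forall i, i \in s -> 0 <= y (inl i) <= 1) ->
  (forall j, Rabs (y (inr j) - x (inr j)) < / K) -> Rabs (f y) <= K.
have mono s x K K' : K <= K' -> good s x K -> good s x K'.
  move=> le [K0 h]; split; first lra.
  have iK := Rinv_le_contravar _ _ K0 le.
  move=> y h1 h2 h3; apply: Rle_trans le; apply: h => // k => [ks|].
    by apply: Rlt_le_trans (h1 k ks) iK.
  exact: Rlt_le_trans (h3 k) iK.
have main s x : domU c rho x -> exists K, good s x K.
  elim: s x => [|i s IH] x Ux.
    have [d1 [d10 h1]] := cf x Ux 1 Rlt_0_1.
    have [d2 [d20 h2]] := open_domU Ux.
    pose d := Rmin d1 d2; have d0 : 0 < d by apply: Rmin_glb_lt.
    exists (/ d + Rabs (f x) + 1).
    have id0 : 0 < / d by exact: Rinv_0_lt_compat.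
    have f0 := Rabs_pos (f x).
    have iK : / (/ d + Rabs (f x) + 1) <= d.
      by rewrite -{2}(Rinv_inv d); apply: Rinv_le_contravar; lra.
    split; first lra.
    move=> y h _ hr.
    have close k : Rabs (y k - x k) < d.
      by case: k => [i|j]; apply: Rlt_le_trans iK; [exact: h | exact: hr].
    have Uy : domU c rho y by apply: h2 => k; apply: Rlt_le_trans (close k) (Rmin_r _ _).
    have := h1 y Uy (fun k => Rlt_le_trans _ _ _ (close k) (Rmin_l _ _)).
    by split_Rabs; lra.
  have [|u|K hK] := @unit_interval_compact (fun u K => good s (upd x (inl i) u) K).
  - by move=> u; apply: mono.
  - have [K [K0 hK]] := IH (upd x (inl i) u) Ux.
    have K2 : 0 < 2 * K by lra.
    (* Half of the radius is spent on moving u to u', the other half on moving y. *)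
    exists (2 * K), (/ (2 * K)); split; first exact: Rinv_0_lt_compat.
    move=> u' hu; split=> // y h1 h2 h3.
    have i2 := Rinv_0_lt_compat _ K2.
    have half : / K = / (2 * K) + / (2 * K) by field; lra.
    suff : Rabs (f y) <= K by lra.
    apply: hK => // [k ks|j].
      have := h1 k ks; rewrite /upd; case: eqP => _; last by move=> ?; lra.
      by move: hu; split_Rabs; lra.
    by apply: Rlt_trans (h3 j) _; lra.
  exists K; have [K0 _] := hK 0 (conj (Rle_refl 0) Rle_0_1); split=> // y h1 h2 h3.
  have [_] := hK (y (inl i)) (h2 i (mem_head _ _)); apply=> // [k ks|k ks].
    rewrite /upd; case: eqP => [[->]|ne].
      by rewrite Rminus_diag Rabs_R0; exact: Rinv_0_lt_compat.
    apply: h1; rewrite in_cons negb_or ks andbT; apply/eqP => e; apply: ne; by rewrite e.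
  by apply: h2; rewrite in_cons ks orbT.
have [K [K0 hK]] := main (enum 'I_p) (mkpoint (fun _ => 0) r) Ur.
have [d [d0 hd]] := open_in_ball Ur.
exists (Rmax K (/ d)); split; first by apply: Rlt_le_trans (Rmax_l _ _).
move=> th r' hr.
have id0 : 0 < / d by exact: Rinv_0_lt_compat.
have Ur' : in_ball c rho r'.
  apply: hd => j; apply: Rlt_le_trans (hr j) _.
  by rewrite -{2}(Rinv_inv d); apply: Rinv_le_contravar => //; exact: Rmax_r.
(* This integer shift brings [th i] into the unit interval. *)
pose z i := (1 - up (th i))%Z.
have zE i : IZR (z i) = 1 - IZR (up (th i)) by rewrite /z minus_IZR.
rewrite -(periodic_lattice th z per Ur').
apply: Rle_trans (Rmax_l K (/ d)); apply: hK => [i|i _|j] /=.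
- by rewrite mem_enum.
- by rewrite zE; have := archimed (th i); lra.
- by apply: Rlt_le_trans (hr j) _; apply: Rinv_le_contravar => //; exact: Rmax_l.
Qed.

Lemma bounded_linear_eq0 g K y : (forall t, Rabs (y + t * g) <= K) -> g = 0.
Proof.
move=> h; apply: NNPP => g0.
have h0 := h 0; have h1 := h ((2 * K + 1) / g).
have e : (2 * K + 1) / g * g = 2 * K + 1 by field.
by move: h0 h1; rewrite e Rmult_0_l Rplus_0_r; split_Rabs; lra.
Qed.

(** * Functions invariant under the flow of Z *)

Section Flow.
Variables (p q : nat) (c : 'I_q -> R) (rho : R) (a : 'I_p -> ('I_q -> R) -> R).

Lemma flow_invariant_of_const_derivative (f : point p q -> R) D r :
  theta_periodic c rho f -> is_deriv_family (domU c rho) f D -> in_ball c rho r ->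
  (forall x y : point p q, domU c rho x -> rpart x = rpart y ->
    \big[Rplus/R0]_(i : 'I_p) (a i (rpart x) * D (mi_e (inl i)) x)
    = \big[Rplus/R0]_(i : 'I_p) (a i (rpart y) * D (mi_e (inl i)) y)) ->
  flow_invariant (fun i => a i r) (fun th => f (mkpoint th r)).
Proof.
move=> per hD Ur hZ; have [D0 [cD dD]] := hD.
have cf : cont_on (domU c rho) f.
  move=> x Ux e e0; have [d [d0 h]] := cD mi0 x Ux e e0.
  by exists d; split=> // y Uy yx; rewrite -!D0 //; apply: h.
have [K [K0 hK]] := locally_bounded_on_torus per cf Ur.
set v := fun i => a i r => t th.
pose g := \big[Rplus/R0]_(i : 'I_p) (a i r * D (mi_e (inl i)) (mkpoint th r)).
have der s : derivable_pt_lim (fun s => f (mkpoint (translate v s th) r)) s g.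
  pose w (k : coord p q) := match k with inl i => a i r | inr _ => 0 end.
  pose x := mkpoint (translate v s th) r.
  have hf : is_family (domU c rho) D by split.
  have := @derivative_along_line _ _ _ x w (@open_domU p q c rho) hf Ur.
  have -> : \big[Rplus/R0]_(k : coord p q) (w k * D (mi_e k) x) = g.
    rewrite big_sumType /= [X in _ + X]big1 => [|j _]; last by rewrite Rmult_0_l.
    rewrite Rplus_0_r; exact: (hZ x (mkpoint th r) Ur).
  (* The derivative along a line is known at parameter 0; composing with u - s moves it to s. *)
  move=> H; have Hs := derivable_pt_lim_minus _ _ _ _ _ (derivable_pt_lim_id s) (derivable_pt_lim_const s s).
  rewrite -[0](Rminus_diag s) in H.
  have := derivable_pt_lim_comp _ _ _ _ _ Hs H.
  rewrite Rminus_0_r Rmult_1_r; congr derivable_pt_lim.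
  apply: functional_extensionality => u; rewrite /comp.
  have -> : (fun k => x k + (id - fct_cte s)%F u * w k) = mkpoint (translate v u th) r.
    by apply: functional_extensionality => -[i|j] /=;
      rewrite /translate /v /minus_fct /id /fct_cte; ring.
  exact: D0.
have lin s : f (mkpoint (translate v s th) r) = f (mkpoint th r) + s * g.
  have dm u : derivable_pt_lim (fun s => f (mkpoint (translate v s th) r) - g * s) u (g - g * 1).
    by apply: derivable_pt_lim_minus => //; apply: derivable_pt_lim_scal (derivable_pt_lim_id u).
  have [u [e _]] := MVT_abs _ _ 0 s (fun u _ => dm u).
  move: e; have -> : g - g * 1 = 0 by ring.
  have -> : translate v 0 th = th.
    by apply: functional_extensionality => i; rewrite /translate; ring.
  by rewrite Rabs_R0 Rmult_0_l; split_Rabs; lra.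
have g0 : g = 0.
  apply: (@bounded_linear_eq0 g K (f (mkpoint th r))) => s; rewrite -lin; apply: hK => j.
  by rewrite Rminus_diag Rabs_R0; exact: Rinv_0_lt_compat.
by rewrite lin g0 Rmult_0_r Rplus_0_r.
Qed.

Hypothesis ca : forall i, cont_on (in_ball c rho) (a i).
Hypothesis inc : incommensurable c rho a.

(** [V] is shrunk once for each k: by incommensurability k . a does not vanish identically on it, so
    the part where it is nonzero is open and nonempty. *)
Lemma nonresonant_nearby (I : eqType) (s : seq I) (k : I -> 'I_p -> Z) V :
  Defs.open_set V -> (exists r, V r) -> (forall r, V r -> in_ball c rho r) ->
  exists r, V r /\ forall j, j \in s -> (exists i, k j i <> 0%Z) ->
    zdot (k j) (fun i => a i r) <> 0.
Proof.
elim: s V => [|j s IH] V oV [r Vr] Vb; first by exists r.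
(* Squaring turns nonvanishing into positivity, an open condition. *)
have cz : cont_on V (fun r => zdot (k j) (fun i => a i r) * zdot (k j) (fun i => a i r)).
  have cz1 : cont_on V (fun r => zdot (k j) (fun i => a i r)).
    apply: cont_on_sum => i; apply: cont_on_mul; first exact: cont_on_const.
    move=> x Vx e e0; have [d [d0 h]] := ca i (Vb x Vx) e0.
    by exists d; split=> // y Vy; apply: h; exact: Vb.
  exact: cont_on_mul.
case: (classic (exists i, k j i <> 0%Z)) => [ex|nex]; last first.
  have [r' [Vr' h]] := IH V oV (ex_intro _ r Vr) Vb.
  exists r'; split=> // j'; rewrite in_cons => /orP[/eqP -> //|]; exact: h.
have [r1 [Vr1 n1]] : exists r1, V r1 /\ zdot (k j) (fun i => a i r1) <> 0.
  apply: NNPP => no; apply: (inc ex); exists V; split=> //; split; first by exists r.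
  by split=> // r' Vr'; apply: NNPP => ne; apply: no; exists r'.
have [||r' [[Vr' n'] h]] := IH _ (open_cont_pos oV cz).
- by exists r1; split=> //; nra.
- by move=> r' [/Vb].
- exists r'; split=> // j'; rewrite in_cons => /orP[/eqP -> _ e|]; last exact: h.
  by move: n'; rewrite e; lra.
Qed.

Lemma one_sub_cos_ge d x : 0 < d <= / 2 -> d <= Rabs x <= / 2 ->
  1 - cos (2 * PI * d) <= 1 - cos (2 * PI * x).
Proof.
move=> hd hx; have P0 := PI_RGT_0.
have -> : cos (2 * PI * x) = cos (2 * PI * Rabs x).
  by rewrite /Rabs; case: Rcase_abs => // _; rewrite -cos_neg; congr cos; ring.
suff : cos (2 * PI * Rabs x) <= cos (2 * PI * d) by lra.
case: (Rle_lt_or_eq_dec d (Rabs x)) => [|lt|->]; [lra | | exact: Rle_refl].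
apply: Rlt_le; apply: cos_decreasing_1; nra.
Qed.

Lemma theta_indep_of_flow_invariant (f : point p q -> R) :
  theta_periodic c rho f -> cont_on (domU c rho) f ->
  (forall r, in_ball c rho r ->
     flow_invariant (fun i => a i r) (fun th => f (mkpoint th r))) ->
  theta_indep c rho f.
Proof.
move=> per cf inv x y Ux exy.
have Uy : domU c rho y by rewrite /domU -exy.
set r := rpart x in Ux exy.
(* The errors add up to less than 5 e: 3 e from the averaged estimate, and e at each of x and y for
   moving r to r'. *)
apply: cond_eq => e5 e50; set e := e5 / 6; have e0 : 0 < e by rewrite /e; lra.
have [K [K0 hK]] := locally_bounded_on_torus per cf Ux.
have [d1 [d10 h1]] := cf x Ux e e0.
have [d2 [d20 h2]] := cf y Uy e e0.
(* The bound 1/2 is for the monotonicity of the cosine, 1/K for the uniform bound on f, and [d1],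
   [d2] for continuity at x and y. *)
pose d := Rmin (/ 2) (Rmin (/ K) (Rmin d1 d2)).
have d0 : 0 < d.
  by do 3?[apply: Rmin_glb_lt => //]; [lra | exact: Rinv_0_lt_compat].
have dh : d <= / 2 by exact: Rmin_l.
have dK : d <= / K by apply: Rle_trans (Rmin_r _ _) (Rmin_l _ _).
have dd1 : d <= d1.
  by do 2?[apply: Rle_trans (Rmin_r _ _) _]; exact: Rmin_l.
have dd2 : d <= d2.
  by do 2?[apply: Rle_trans (Rmin_r _ _) _]; exact: Rmin_r.
have P0 := PI_RGT_0.
pose eta := 1 - cos (2 * PI * d).
have eta0 : 0 < eta.
  suff : cos (2 * PI * d) < cos 0 by rewrite cos_0 /eta; lra.
  apply: cos_decreasing_1; nra.
(* Away from the lattice some 1 - cos is at least [eta], so [B] times it covers the largest possible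
   difference 2 K. *)
pose B := 2 * K / eta.
have B0 : 0 <= B by apply: Rlt_le; apply: Rdiv_lt_0_compat; lra.
have [n hn] : exists n, B * INR p / INR n.+1 <= e.
  have [n hn] := INR_unbounded (B * INR p / e).
  exists n; have n0 : 0 < INR n.+1 by apply: lt_0_INR; lia.
  apply: (Rmult_le_reg_r (INR n.+1 / e)); first exact: Rdiv_lt_0_compat.
  have -> : B * INR p / INR n.+1 * (INR n.+1 / e) = B * INR p / e by field; lra.
  have -> : e * (INR n.+1 / e) = INR n.+1 by field; lra.
  by rewrite S_INR; lra.
pose V r' := in_ball c rho r' /\ forall j, Rabs (r' j - r j) < d.
have oV : Defs.open_set V.
  move=> r' [Br' cr'].
  have [e1 [e10 he1]] := open_in_ball Br'.
  have [e2 [e20 he2]] : exists e2, 0 < e2 /\ forall j, Rabs (r' j - r j) <= d - e2.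
    have : forall s : seq 'I_q, exists e2, 0 < e2 /\
        forall j, j \in s -> Rabs (r' j - r j) <= d - e2.
      elim=> [|j s [e2 [e20 he2]]]; first by exists 1; split=> //; lra.
      exists (Rmin e2 (d - Rabs (r' j - r j))); split.
        by apply: Rmin_glb_lt => //; have := cr' j; lra.
      move=> j'; rewrite in_cons => /orP[/eqP ->|/he2 h].
        by have := Rmin_r e2 (d - Rabs (r' j - r j)); lra.
      by have := Rmin_l e2 (d - Rabs (r' j - r j)); lra.
    move/(_ (enum 'I_q)) => [e2 [e20 he2]]; exists e2; split=> // j.
    by apply: he2; rewrite mem_enum.
  exists (Rmin e1 e2); split; first exact: Rmin_Rgt_r.
  move=> r'' hr; split; first by apply: he1 => j; apply: Rlt_le_trans (hr j) (Rmin_l _ _).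
  move=> j; have := Rlt_le_trans _ _ _ (hr j) (Rmin_r _ _); have := he2 j.
  by split_Rabs; lra.
have Vr : V r by split=> // j; rewrite Rminus_diag Rabs_R0.
(* A finite indexing of all integer vectors with entries between -(n + 1) and n + 1. *)
pose k (m : {ffun 'I_p -> 'I_(2 * n.+1).+1}) i := (Z.of_nat (m i) - Z.of_nat n.+1)%Z.
have [r' [[Br' cr'] gen]] := nonresonant_nearby
  (index_enum {ffun 'I_p -> 'I_(2 * n.+1).+1}) k oV (ex_intro _ r Vr) (fun r h => proj1 h).
have gen' (l : 'I_p -> Z) : (exists i, l i <> 0%Z) ->
    (forall i, (Z.abs (l i) <= Z.of_nat n.+1)%Z) -> zdot l (fun i => a i r') <> 0.
  move=> ex small.
  have kE : k [ffun i => inord (Z.to_nat (l i + Z.of_nat n.+1))] = l.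
    apply: functional_extensionality => i; rewrite /k ffunE inordK.
      by have := small i; lia.
    by apply/leP; have := small i; rewrite -multE; lia.
  by have := gen [ffun i => inord (Z.to_nat (l i + Z.of_nat n.+1))]; rewrite kE; apply.
pose F th := f (mkpoint th r').
have near (z : point p q) th : rpart z = r -> (forall i, Rabs (th i - tpart z i) < d) ->
    forall k, Rabs (mkpoint th r' k - z k) < d.
  by move=> zr ht [i|j] /=; [exact: ht | have := cr' j; rewrite -zr].
have near0 (z : point p q) : rpart z = r -> forall k, Rabs (mkpoint (tpart z) r' k - z k) < d.
  by move=> zr; apply: near => // i; rewrite Rminus_diag Rabs_R0.
have Fx th : (forall i, Rabs (th i - tpart x i) < d) -> Rabs (F th - f x) < e.
  by move=> ht; apply: h1 => // i; apply: Rlt_le_trans dd1; apply: near.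
have Fy : Rabs (F (tpart y) - f y) < e.
  by apply: h2 => // i; apply: Rlt_le_trans dd2; apply: near0.
have Fx0 : Rabs (F (tpart x) - f x) < e.
  by apply: Fx => i; rewrite Rminus_diag Rabs_R0.
have FK th : Rabs (F th) <= K by apply: hK => j; apply: Rlt_le_trans (cr' j) dK.
(* Recentring at x puts the point of reference at the zero of the weight. *)
pose G th := F (fun i => tpart x i + th i).
have Gbound th : Rabs (G th - G (fun _ => 0))
    <= 2 * e + B * \big[Rplus/R0]_(j : 'I_p) (1 - cos (2 * PI * th j)).
  have G0 : G (fun _ => 0) = F (tpart x).
    by congr F; apply: functional_extensionality => i; rewrite Rplus_0_r.
  have term0 j : 0 <= 1 - cos (2 * PI * th j) by have := COS_bound (2 * PI * th j); lra.
  have sum0 (P : pred 'I_p) : 0 <= \big[Rplus/R0]_(j | P j) (1 - cos (2 * PI * th j)).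
    by apply: (big_ind (fun r => 0 <= r)) => [|u v|j _]; [lra | lra | exact: term0].
  (* This shift brings [th i] into [-1/2, 1/2]: either all entries are then below [d] and continuity
     at x applies, or one entry makes the cosine term large. *)
  pose z i := (1 - up (th i + / 2))%Z.
  have zh i : Rabs (th i + IZR (z i)) <= / 2.
    by rewrite /z minus_IZR; have := archimed (th i + / 2); split_Rabs; lra.
  case: (classic (forall i, Rabs (th i + IZR (z i)) < d)) => [all|nall].
    have -> : G th = F (fun i => tpart x i + (th i + IZR (z i))).
      rewrite /G /F -(periodic_lattice _ z per Br'); congr f; congr mkpoint.
      by apply: functional_extensionality => i; ring.
    have := Fx (fun i => tpart x i + (th i + IZR (z i))).
    move/(_ (fun i => eq_ind_r (fun u => Rabs u < d) (all i) (Rplus_minus_l _ _))).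
    move=> h; apply: (Rle_trans _ (2 * e + 0)); last first.
      by apply: Rplus_le_compat_l; apply: Rmult_le_pos B0 (sum0 xpredT).
    by move: h Fx0; rewrite G0; split_Rabs; lra.
  have [i hi] : exists i, d <= Rabs (th i + IZR (z i)).
    apply: NNPP => nex; apply: nall => i; apply: Rnot_le_lt => h.
    by apply: nex; exists i.
  have ci : eta <= 1 - cos (2 * PI * th i).
    have -> : cos (2 * PI * th i) = cos (2 * PI * (th i + IZR (z i))).
      have -> : 2 * PI * (th i + IZR (z i)) = 2 * PI * th i + 2 * IZR (z i) * PI by ring.
      have [m [e1|e1]] : exists m, IZR (z i) = INR m \/ IZR (z i) = - INR m.
        exists (Z.to_nat (Z.abs (z i))); rewrite INR_IZR_INZ Z2Nat.id; last lia.
        case: (Z.abs_spec (z i)) => -[_ ->]; [left | right] => //.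
        by rewrite opp_IZR; ring.
      + by rewrite e1 cos_period.
      + rewrite e1 -(cos_period (_ + _) m); congr cos; ring.
    by apply: one_sub_cos_ge.
  have : B * eta <= B * \big[Rplus/R0]_(j : 'I_p) (1 - cos (2 * PI * th j)).
    apply: Rmult_le_compat_l => //; rewrite (bigD1 i) //=.
    by rewrite -[eta]Rplus_0_r; exact: Rplus_le_compat ci (sum0 _).
  have -> : B * eta = 2 * K by rewrite /B; field; lra.
  by have := FK (fun i => tpart x i + th i); have := FK (fun i => tpart x i + 0);
    rewrite -/(G th) -/(G (fun _ => 0)); split_Rabs; lra.
have Ginv : flow_invariant (fun i => a i r') G.
  move=> t th; rewrite /G /F -[RHS](inv r' Br' t); congr f; congr mkpoint.
  by apply: functional_extensionality => i; rewrite /translate; ring.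
pose th0 i := tpart y i - tpart x i.
have Gth0 : G th0 = F (tpart y).
  by congr F; apply: functional_extensionality => i; rewrite /th0; ring.
have G0 : G (fun _ => 0) = F (tpart x).
  by congr F; apply: functional_extensionality => i; rewrite Rplus_0_r.
(* The absolute value is not flow-linear, so its two one-sided bounds are averaged separately, at
   the displacement [th0] from x to y. *)
have up1 : 0 <= 2 * e + (G th0 - G (fun _ => 0)) + B * INR p / INR n.+1.
  apply: (@fejer_mean_ge0 p (fun i => a i r') n (fun th => 2 * e + (G th - G (fun _ => 0)))) => //.
    by move=> t th; rewrite Ginv.
  by move=> th; have := Gbound th; split_Rabs; lra.
have up2 : 0 <= 2 * e - (G th0 - G (fun _ => 0)) + B * INR p / INR n.+1.
  apply: (@fejer_mean_ge0 p (fun i => a i r') n (fun th => 2 * e - (G th - G (fun _ => 0)))) => //.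
    by move=> t th; rewrite Ginv.
  by move=> th; have := Gbound th; split_Rabs; lra.
move: up1 up2 Fx0 Fy; rewrite Gth0 G0 => up1 up2 Fx0 Fy.
have ee : e5 = 6 * e by rewrite /e; field.
rewrite ee; move: Fx0 Fy; split_Rabs; lra.
Qed.

End Flow.

(** * Descending induction on the weight of the coefficients *)

Theorem mainTheorem10 (p q N : nat) (c : 'I_q -> R) (rho : R)
  (a : 'I_p -> ('I_q -> R) -> R)
  (C : mindex p q N -> point p q -> R) :
  (0 < rho)%R ->
  (forall i, smooth_on (in_ball c rho) (a i)) ->
  incommensurable c rho a ->
  (forall al, smooth_fun_U c rho (C al)) ->
  (* Z o Lambda - Lambda o Z = 0 on smooth functions on U *)
  (forall (f : point p q -> R) Df,
     theta_periodic c rho f -> is_deriv_family (domU c rho) f Df ->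
     forall DZ, is_deriv_family (domU c rho) (applyZ a Df) DZ ->
     forall DL, is_deriv_family (domU c rho) (applyL C Df) DL ->
     forall x, domU c rho x -> applyZ a DL x = applyL C DZ x) ->
  (* all coefficients are independent of theta *)
  forall (al : mindex p q N) (x y : point p q),
    domU c rho x -> (forall j, x (inr j) = y (inr j)) -> C al x = C al y.
Proof.
move=> _ sa inc sC comm al x y Ux exy.
pose Da i := proj1_sig (constructive_indefinite_description _ (sa i)).
have hDa i : is_deriv_family (in_ball c rho) (a i) (Da i).
  exact: (proj2_sig (constructive_indefinite_description _ (sa i))).
pose DC be := proj1_sig (constructive_indefinite_description _ (proj2 (sC be))).
have hDC be : is_deriv_family (domU c rho) (C be) (DC be).
  exact: (proj2_sig (constructive_indefinite_description _ (proj2 (sC be)))).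
have cont_of (T : finType) (U : (T -> R) -> Prop) f D : is_deriv_family U f D -> cont_on U f.
  move=> [D0 [cD _]] z Uz e e0; have [d [d0 h]] := cD mi0 z Uz e e0.
  by exists d; split=> // z' Uz' zz; rewrite -!D0 //; apply: h.
(* [n] exceeds the distance of the weight of [be] from the maximal weight, so ordinary induction on
   [n] runs down the weights. *)
suff main n (be : mindex p q N) :
    (\big[maxn/O]_(ga : mindex p q N) weight N (mi_of ga) - weight N (mi_of be) < n)%nat ->
    theta_indep c rho (C be).
  by apply: (main _ al (ltnSn _)) => //; apply: functional_extensionality.
elim: n be => [//|n IH] be hn.
have above ga : (weight N (mi_of be) < weight N (mi_of ga))%nat -> theta_indep c rho (C ga).
  move=> lt; apply: IH; rewrite -ltnS; apply: leq_trans hn; rewrite ltnS.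
  apply: ltn_sub2l => //; apply: leq_trans lt _.
  exact: (@leq_bigmax _ (fun ga : mindex p q N => weight N (mi_of ga)) ga).
apply: (@theta_indep_of_flow_invariant p q c rho a) => //.
- by move=> i; apply: cont_of (hDa i).
- exact: (proj1 (sC be)).
- exact: cont_of (hDC be).
- move=> r Ur; apply: (flow_invariant_of_const_derivative (proj1 (sC be)) (hDC be) Ur).
  by move=> z z' Uz zz; apply: (Z_coeff_indep hDa hDC comm above).
Qed.
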